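(* Let $\mathfrak a>0$, $\mathfrak h,p\ge 1$, put $\mathfrak p=\lceil \mathfrak h/\mathfrak a\rceil$, $q=p\,2^{\mathfrak p+4}$, and let $J_m^+\in\mathbb N$. Let $\mathcal D,\widehat{\mathcal D}$ be as in the context, and assume that for a universal constant $C$ and a universal sequence $s_m=o(1)$, as $m\to\infty$: (1) $m^{1/2}\max_{i,j\in\mathbb N}\|\overline{\eta}^{\mathcal D}_{i,j}(m)\|_q\le C$ and $m^{1/2}\max_{i,j\in\mathbb N}\|\eta^{\mathcal R}_{i,j}(m)\|_q\le s_m$; (2) $\max_{1\le j\le J_m^+}\Big\{m^{-1/2+\mathfrak a}\sum_{i\ne j}\frac{\lambda_i}{|\lambda_j-\lambda_i|},\ m^{-1+2\mathfrak a}\sum_{i\neq j}\frac{\lambda_i\lambda_j}{(\lambda_j-\lambda_i)^2}\Big\}\le C$ and $\lambda_{J_m^+}\ge m^{-\mathfrak h}/C$; (3) $1/C\le \mathbb E[\eta^{\mathcal D}_{j,j}(m)]\le C$ for all $j\in\mathbb N$, and $\sum_{j\ge1}\lambda_j\le C$. Then for $1\le J<J_m^+$, $$\Big\|\max_{1\le j\le J}\Big|\frac1{\lambda_j}\big(\widehat\lambda_j-\lambda_j-I_{j,j}\big)\Big|\Big\|_p\lesssim \frac{J^{1/p}m^{-\mathfrak a}}{\sqrt m}.$$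
   Context: $\mathcal T\subset\mathbb R^d$ is compact, $L^2=L^2(\mathcal T)$ with inner product $\langle\cdot,\cdot\rangle$ and norm $\|\cdot\|_{L^2}$. For a real random variable $Y$, $\|Y\|_q=(\mathbb E|Y|^q)^{1/q}$ and $\overline Y=Y-\mathbb E Y$. $A\lesssim B$ means $A\le cB$ with a constant $c$ not depending on $m,j,J$. ''Universal'' means not depending on $m$ or on indices. Setup. $m$ runs through a sequence tending to infinity; all objects below may depend on $m$. The operator $\mathcal D:L^2\to L^2$ has non-negative eigenvalues $\lambda_1\ge\lambda_2\ge\dots$ and an orthonormal basis of eigenfunctions $(e_j)_{j\in\mathbb N}$, with $\mathcal D(\cdot)=\sum_j\lambda_j\langle e_j,\cdot\rangle e_j$, $\sum_j\lambda_j<\infty$. For non-negative numbers $\widetilde\lambda_j$ with $\sum_j\widetilde\lambda_j<\infty$ and real random variables $\eta^{\mathcal D}_{i,j}=\eta^{\mathcal D}_{i,j}(m)$, $\eta^{\mathcal R}_{i,j}=\eta^{\mathcal R}_{i,j}(m)$, $i,j\in\mathbb N$, put $$\widehat{\mathcal D}(\cdot)=\sum_{i,j\ge1}\sqrt{\widetilde\lambda_i\widetilde\lambda_j}\,(\eta^{\mathcal D}_{i,j}-\eta^{\mathcal R}_{i,j})\langle e_i,\cdot\rangle e_j,$$ where it is required that $\mathcal D(\cdot)=\sum_{i,j\ge1}\sqrt{\widetilde\lambda_i\widetilde\lambda_j}\,\mathbb E[\eta^{\mathcal D}_{i,j}]\langle e_i,\cdot\rangle e_j$. The operator $\widehat{\mathcal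 D}$ is self-adjoint, with $\widehat{\mathcal D}(\widehat e_j)=\widehat\lambda_j\widehat e_j$, where $\widehat\lambda_j$ is the $j$-th largest eigenvalue and the $\widehat e_j$ are orthonormal, with signs chosen so that $\langle\widehat e_j,e_j\rangle\ge0$. Finally $I_{i,j}=\langle(\widehat{\mathcal D}-\mathcal D)(e_i),e_j\rangle$. *)

(* Defs.v *)
From HB Require Import structures.
From mathcomp Require Import all_boot all_order all_algebra.
From mathcomp Require Import all_classical all_reals all_analysis.

Set Implicit Arguments.
Unset Strict Implicit.
Unset Printing Implicit Defensive.

Import Order.TTheory GRing.Theory Num.Theory.
Import numFieldNormedType.Exports.

Local Open Scope classical_set_scope.
Local Open Scope ring_scope.

Section measurable_rV.
Context (R : realType) (n : nat).

Let coor (i : 'I_n) (x : 'rV[R]_n) : measurableTypeR R := x ord0 i.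

Let rV_set0 : g_sigma_preimage coor set0.
Proof. exact: sigma_algebra0. Qed.

Let rV_setC A : g_sigma_preimage coor A -> g_sigma_preimage coor (~` A).
Proof. exact: sigma_algebraC. Qed.

Let rV_bigcup (F : _^nat) : (forall i, g_sigma_preimage coor (F i)) ->
  g_sigma_preimage coor (\bigcup_i (F i)).
Proof. exact: sigma_algebra_bigcup. Qed.

(* The library puts no sigma-algebra on R^n; this is the product of the Borel
   ones, as for [n.-tuple]. It contains the open sets ([open_rV_measurable]),
   hence is the Borel sigma-algebra of R^n. *)
HB.instance Definition _ := @isMeasurable.Build
  (measure_tuple_display default_measure_display)
  'rV[R]_n (g_sigma_preimage coor) rV_set0 rV_setC rV_bigcup.

Lemma measurable_coor (i : 'I_n) :
  measurable_fun [set: 'rV[R]_n] (fun x => x ord0 i : measurableTypeR R).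
Proof.
move=> _ Y mY; rewrite setTI; apply: sub_sigma_algebra => /=.
rewrite -bigcup_seq/=; exists i => /=; first by rewrite mem_index_enum.
by exists Y => //; rewrite setTI.
Qed.

Lemma measurable_fun_rV d (T : measurableType d) (f : T -> 'rV[R]_n) :
  (forall i, measurable_fun [set: T] (fun t => f t ord0 i : measurableTypeR R)) ->
  measurable_fun [set: T] f.
Proof.
move=> mf _ Y; rewrite setTI.
suff : measurable `<=` [set A | measurable (f @^-1` A)] by apply.
apply: smallest_sub.
  split => //=.
  - by rewrite preimage_set0.
  - by move=> A mA; rewrite setTD preimage_setC; exact: measurableC.
  - by move=> F mF; rewrite preimage_bigcup; exact: bigcup_measurable.
rewrite -bigcup_seq => A [i _ [B mB <-]] /=.
rewrite setTI -comp_preimage -[X in measurable X]setTI.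
exact: mf.
Qed.

Lemma open_rV_measurable (U : set 'rV[R]_n) : open U -> measurable U.
Proof.
move=> oU.
pose box (qk : 'rV[rat]_n * nat) : set 'rV[R]_n :=
  \bigcap_(i in [set: 'I_n]) ((fun x => x ord0 i : measurableTypeR R) @^-1`
    ball (ratr (qk.1 ord0 i) : R) qk.2.+1%:R^-1).
have mbox qk : measurable (box qk).
  apply: fin_bigcap_measurable => // i _.
  rewrite -[X in measurable X]setTI; apply: measurable_coor => //.
  by apply: measurable_realfun.open_measurable; exact: ball_open.
pose V qk := if `[< box qk `<=` U >] then box qk else set0.
have -> : U = \bigcup_qk V qk.
  apply/seteqP; split => [x Ux|x [qk _]]; last first.
    by rewrite /V; case: ifPn => // /asboolP; apply.
  have : nbhs x U by exact: open_nbhs_nbhs.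
  move=> /nbhs_ballP[e /= e0 xeU].
  have [k ke] : exists k, k.+1%:R^-1 < e / 2 :> R.
    have e20 : 0 < e / 2 by rewrite divr_gt0.
    exists (Num.truncn (e / 2)^-1).
    by rewrite invf_plt ?posrE// truncnS_gt.
  have k0 : 0 < k.+1%:R^-1 :> R by rewrite invr_gt0.
  have /choice[q qx] (i : 'I_n) : exists q : rat,
      `|ratr q - x ord0 i| < k.+1%:R^-1.
    have /rat_in_itvoo[q] : x ord0 i - k.+1%:R^-1 < x ord0 i + k.+1%:R^-1.
      by rewrite ltrD2l gtrN.
    by rewrite in_itv/= => qP; exists q; rewrite ltr_distl.
  exists (\row_i q i, k) => //; rewrite /V ifT.
    by move=> i _ /=; rewrite mxE -ball_normE /= qx.
  apply/asboolP => y yq; apply: xeU; split => // i j.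
  rewrite ord1; have /= := yq j I.
  rewrite mxE -!ball_normE /= => qy.
  rewrite (splitr e) -(subrKA (ratr (q j))) (le_lt_trans (ler_normD _ _))//.
  by rewrite ltrD// (lt_trans _ ke)// distrC.
apply: countable_bigcupT_measurable => // qk; rewrite /V.
by case: ifPn => // _; exact: measurable0.
Qed.

Lemma compact_rV_measurable (A : set 'rV[R]_n) : compact A -> measurable A.
Proof.
move=> cA; rewrite -[A]setCK; apply: measurableC; apply: open_rV_measurable.
by rewrite openC; apply: compact_closed => //; exact: norm_hausdorff.
Qed.

End measurable_rV.

Lemma sigma_finite_product d1 d2 (T1 : measurableType d1)
    (T2 : measurableType d2) (R : realType)
    (m1 : {sigma_finite_measure set T1 -> \bar R})
    (m2 : {sigma_finite_measure set T2 -> \bar R}) :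
  sigma_finite setT (m1 \x m2)%E.
Proof.
have /sigma_finiteP[F [TF ndF Foo]] := sigma_finiteT m1.
have /sigma_finiteP[G [TG ndG Goo]] := sigma_finiteT m2.
exists (fun n => F n `*` G n) => [|k].
  rewrite -setXTT TF TG predeqE => -[x y]; split.
    move=> [/= [n _ Fnx] [k _ Gky]]; exists (maxn n k) => //; split.
    - by move: x Fnx; exact/subsetPset/ndF/leq_maxl.
    - by move: y Gky; exact/subsetPset/ndG/leq_maxr.
  by move=> [n _ []/= ? ?]; split; exists n.
have [? ?] := Foo k; have [? ?] := Goo k.
split; first exact: measurableX.
by rewrite product_measure1E// lte_mul_pinfty// ge0_fin_numE.
Qed.

Section lebesgue_rV.
Context (R : realType) (n : nat).
Variable mu : {sigma_finite_measure set 'rV[R]_n -> \bar R}.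

Let cons_rV (xy : measurableTypeR R * 'rV[R]_n) : 'rV[R]_n.+1 :=
  row_mx (const_mx xy.1 : 'rV_1) xy.2.

Let uncons_rV (x : 'rV[R]_n.+1) : measurableTypeR R * 'rV[R]_n :=
  (x ord0 ord0, rsubmx (x : 'rV_(1 + n))).

Lemma cons_rV0 (x : R) (y : 'rV[R]_n) :
  (row_mx (const_mx x : 'rV_1) y : 'rV[R]_n.+1) ord0 ord0 = x.
Proof.
transitivity (row_mx (const_mx x : 'rV_1) y ord0 (lshift n ord0)).
  by congr fun_of_matrix; exact/val_inj.
by rewrite row_mxEl mxE.
Qed.

Lemma cons_rV_lift (x : R) (y : 'rV[R]_n) (i : 'I_n) :
  (row_mx (const_mx x : 'rV_1) y : 'rV[R]_n.+1) ord0 (lift ord0 i) = y ord0 i.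
Proof.
transitivity (row_mx (const_mx x : 'rV_1) y ord0 (rshift 1 i)).
  by congr fun_of_matrix; exact/val_inj.
by rewrite row_mxEr.
Qed.

Let cons_rVK : cancel cons_rV uncons_rV.
Proof.
move=> [x y]; congr pair; last by rewrite /= row_mxKr.
exact: cons_rV0.
Qed.

Let measurable_cons_rV : measurable_fun [set: _] cons_rV.
Proof.
apply: measurable_fun_rV => i; case: (unliftP ord0 i) => [j|] ->.
- rewrite [X in measurable_fun _ X](_ : _ =
      (fun x : 'rV[R]_n => x ord0 j : measurableTypeR R) \o snd).
    apply: measurableT_comp; [exact: (@measurable_coor R n j)|].
    exact: measurable_snd.
  by apply/funext => -[x y]; rewrite [LHS]cons_rV_lift.
- rewrite [X in measurable_fun _ X](_ : _ = fst); first exact: measurable_fst.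
  by apply/funext => -[x y]; rewrite [LHS]cons_rV0.
Qed.

Let measurable_uncons_rV : measurable_fun [set: _] uncons_rV.
Proof.
apply/measurable_fun_pairP; split; first exact: (@measurable_coor R n.+1).
apply: measurable_fun_rV => i /=.
under eq_fun do rewrite mxE.
exact: (@measurable_coor R n.+1).
Qed.

(* Lebesgue measure on R^(n+1) = R * R^n, given that [mu] is the one on R^n. *)
Definition lebesgue_rV_succ : set 'rV[R]_n.+1 -> \bar R :=
  pushforward (@lebesgue_measure R \x mu)%E cons_rV.

Let lebesgue_rV_succ0 : lebesgue_rV_succ set0 = 0%E.
Proof. by rewrite /lebesgue_rV_succ /pushforward preimage_set0 measure0. Qed.

Let lebesgue_rV_succ_ge0 A : (0 <= lebesgue_rV_succ A)%E.
Proof. exact: measure_ge0. Qed.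

Let lebesgue_rV_succ_sigma_additive : semi_sigma_additive lebesgue_rV_succ.
Proof.
have mpre A : measurable A -> measurable (cons_rV @^-1` A).
  by move=> mA; rewrite -[X in measurable X]setTI; exact: measurable_cons_rV.
move=> F mF tF mUF; rewrite /lebesgue_rV_succ /pushforward preimage_bigcup.
apply: measure_semi_sigma_additive.
- by move=> k; exact: mpre.
- apply/trivIsetP => /= i j _ _ ij; rewrite -preimage_setI.
  by move/trivIsetP : tF => /(_ _ _ _ _ ij) ->//; rewrite preimage_set0.
- by rewrite -preimage_bigcup; exact: mpre.
Qed.

HB.instance Definition _ := isMeasure.Build _ _ _ lebesgue_rV_succ
  lebesgue_rV_succ0 lebesgue_rV_succ_ge0 lebesgue_rV_succ_sigma_additive.

Let sigma_finite_lebesgue_rV_succ : sigma_finite setT lebesgue_rV_succ.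
Proof.
have [F FT mF] := sigma_finite_product (@lebesgue_measure R) mu.
exists (fun k => uncons_rV @^-1` F k) => [|k].
  by rewrite -preimage_bigcup -FT preimage_setT.
have [mFk Fkoo] := mF k.
split; first by rewrite -[X in measurable X]setTI; exact: measurable_uncons_rV.
rewrite /lebesgue_rV_succ /pushforward -comp_preimage.
by rewrite (_ : _ \o _ = id)//; apply/funext => x; exact: cons_rVK.
Qed.

HB.instance Definition _ := Measure_isSigmaFinite.Build _ _ _
  lebesgue_rV_succ sigma_finite_lebesgue_rV_succ.

End lebesgue_rV.

Fixpoint lebesgue_rV (R : realType) (n : nat) :
    {sigma_finite_measure set 'rV[R]_n -> \bar R} :=
  if n is k.+1 then lebesgue_rV_succ (lebesgue_rV R k)
  else \d_(0 : 'rV[R]_0).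

(* This determines the measure, hence identifies it as Lebesgue's. *)
Lemma lebesgue_rV_box (R : realType) (n : nat)
    (A : 'I_n -> set (measurableTypeR R)) :
  (forall i, measurable (A i)) ->
  lebesgue_rV R n [set x | forall i, A i (x ord0 i)] =
  (\prod_(i < n) lebesgue_measure (A i))%E.
Proof.
elim: n A => [|n IH] A mA.
  rewrite big_ord0 /= diracE (_ : _ \in _)//.
  by rewrite inE => -[].
rewrite big_ord_recl -IH// -product_measure1E//; last first.
  rewrite (_ : [set _ | _] = \bigcap_(i in [set: 'I_n])
      ((fun x => x ord0 i : measurableTypeR R) @^-1` A (lift ord0 i))).
    apply: fin_bigcap_measurable => // i _.
    by rewrite -[X in measurable X]setTI; exact: measurable_coor.
  by apply/seteqP; split => x /= xA i; [move=> _|]; exact: xA.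
congr product_measure1; apply/seteqP; split => -[x y] /=.
- move=> xyA; split => [|i].
  + by have := xyA ord0; rewrite cons_rV0.
  + by have := xyA (lift ord0 i); rewrite cons_rV_lift.
- move=> [xA yA] i; case: (unliftP ord0 i) => [j|] ->.
  + by rewrite cons_rV_lift; exact: yA.
  + by rewrite cons_rV0.
Qed.

Section L2.
Context d (X : measurableType d) (R : realType).
Variable mu : {measure set X -> \bar R}.

(* Square-integrable functions. Elements are functions, not classes: equality in
   L^2 is [f = g %[ae mu]], and limits are taken in the seminorm [L2norm]. *)
Definition L2 := LfunType mu (lee1n 2).

Definition L2dot (f g : L2) : R := \int[mu]_x (f x * g x).

Definition L2norm (f : L2) : R := fine 'N[mu]_2%:E[EFin \o f].

Definition L2cvg (u : nat -> L2) (f : L2) : Prop :=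
  L2norm (u N - f) @[N --> \oo] --> 0.

Definition orthonormal_seq (e : nat -> L2) : Prop :=
  forall i j, L2dot (e i) (e j) = (i == j)%:R.

Definition orthonormal_basis (e : nat -> L2) : Prop :=
  orthonormal_seq e /\
  forall f, L2cvg (fun N => \sum_(j < N) L2dot (e j) f *: e j) f.

(* A(.) = sum_{i,j} a_{i,j} <e_i, .> e_j *)
Definition matrix_operator (e : nat -> L2) (a : nat -> nat -> R)
    (A : L2 -> L2) : Prop :=
  forall f, L2cvg
    (fun N => \sum_(i < N) \sum_(j < N) (a i j * L2dot (e i) f) *: e j) (A f).

Definition self_adjoint (A : L2 -> L2) : Prop :=
  forall f g, L2dot (A f) g = L2dot f (A g).

Definition eigenfunction (A : L2 -> L2) (l : R) (f : L2) : Prop :=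
  ~ (f = cst 0 %[ae mu]) /\ A f = l \*o f %[ae mu].

(* [l j] is the [j]-th largest eigenvalue of [A], counted with multiplicity, and
   [u] are orthonormal eigenfunctions: [l j] is the largest eigenvalue
   having an eigenfunction orthogonal to [u 0], ..., [u (j-1)]. In particular [l]
   is nonincreasing. [A] may have negative eigenvalues, so completeness of [u] is
   not demanded. *)
Definition ordered_eigensystem (A : L2 -> L2) (l : nat -> R) (u : nat -> L2)
    : Prop :=
  [/\ orthonormal_seq u,
      forall j, eigenfunction A (l j) (u j) &
      forall j l' f, eigenfunction A l' f ->
        (forall i, (i < j)%N -> L2dot (u i) f = 0) -> l' <= l j].

End L2.

(* Lebesgue measure on the compact set [T]; [L2 (lebesgue_on cT)] is L^2(T). *)
Definition lebesgue_on (R : realType) (d : nat) (T : set 'rV[R]_d)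
    (cT : compact T) : {measure set 'rV[R]_d -> \bar R} :=
  mrestr (lebesgue_rV R d) (compact_rV_measurable cT).

Definition centered d (Omega : measurableType d) (R : realType)
    (P : probability Omega R) (Y : Omega -> R) (w : Omega) : R :=
  Y w - fine 'E_P[Y].

(* The objects attached to one value of m. The indices 1, 2, ... are shifted to
   0, 1, ..., so [lambda 0] is the largest eigenvalue. The series
   and the spectral identities for the random operator hold almost surely.
   [Dhat_measurable] says that [opDhat] is a (weakly) random operator, so that
   the [Idev] below are random variables. *)
Record eigen_setup d (X : measurableType d) (R : realType)
    (mu : {measure set X -> \bar R}) := EigenSetup {
  Omega_disp : measure_display ;
  Omega : measurableType Omega_disp ;
  Pr : probability Omega R ;
  eig : nat -> L2 mu ;
  lambda : nat -> R ;
  opD : L2 mu -> L2 mu ;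
  lambdat : nat -> R ;
  etaD : nat -> nat -> {RV Pr >-> R} ;
  etaR : nat -> nat -> {RV Pr >-> R} ;
  opDhat : Omega -> L2 mu -> L2 mu ;
  lambdahat : nat -> {RV Pr >-> R} ;
  ehat : nat -> Omega -> L2 mu ;
  eig_basis : orthonormal_basis eig ;
  lambda_ge0 : forall j, 0 <= lambda j ;
  lambda_noninc : forall j, lambda j.+1 <= lambda j ;
  lambda_summable : (\sum_(j <oo) (lambda j)%:E < +oo)%E ;
  D_spectral : forall f,
    L2cvg (fun N => \sum_(j < N) (lambda j * L2dot (eig j) f) *: eig j) (opD f) ;
  lambdat_ge0 : forall j, 0 <= lambdat j ;
  lambdat_summable : (\sum_(j <oo) (lambdat j)%:E < +oo)%E ;
  etaD_integrable : forall i j, Pr.-integrable setT (EFin \o etaD i j) ;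
  D_expansion : matrix_operator eig (fun i j =>
    Num.sqrt (lambdat i * lambdat j) * fine 'E_Pr[etaD i j]) opD ;
  Dhat_measurable : forall f g,
    measurable_fun [set: Omega] (fun w => L2dot (opDhat w f) g) ;
  Dhat_expansion : {ae Pr, forall w, matrix_operator eig (fun i j =>
    Num.sqrt (lambdat i * lambdat j) * (etaD i j w - etaR i j w)) (opDhat w)} ;
  Dhat_self_adjoint : {ae Pr, forall w, self_adjoint (opDhat w)} ;
  Dhat_eigensystem : {ae Pr, forall w,
    ordered_eigensystem (opDhat w) (lambdahat ^~ w) (ehat ^~ w)} ;
  ehat_sign : {ae Pr, forall w, forall j, 0 <= L2dot (ehat j w) (eig j)} }.

(* I_{i,j} = <(Dhat - D)(e_i), e_j> *)
Definition Idev d (X : measurableType d) (R : realType)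
    (mu : {measure set X -> \bar R}) (S : eigen_setup mu) (i j : nat)
    (w : Omega S) : R :=
  L2dot (opDhat w (eig S i) - opD S (eig S i)) (eig S j).

Arguments Idev {d X R mu} S i j w.

(* Main.v *)
Require Import Defs.
From HB Require Import structures.
From mathcomp Require Import all_boot all_order all_algebra.
From mathcomp Require Import all_classical all_reals all_analysis.
From mathcomp Require Import measurable_realfun.
From mathcomp Require Import ring lra.

Set Implicit Arguments.
Unset Strict Implicit.
Unset Printing Implicit Defensive.

Import Order.TTheory GRing.Theory Num.Theory.
Import numFieldNormedType.Exports.

Local Open Scope classical_set_scope.
Local Open Scope ring_scope.

(** In the basis (e_i) the random operator has the matrix
    a_{ik} = lambda_i 1_{i=k} + E_{ik} with E_{ik} = (lt_i lt_k)^(1/2) Y_{ik},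
    where lt is the sequence lambda-tilde and Y_{ik} is the centred eta^D minus
    eta^R: the mean of the expansion is diagonal because it represents D, and
    E_{jj} = I_{jj} ([mean_entry], [noise_entry]). As the mean of eta^D_{ii} is at
    least 1/C, lt_i <= C lambda_i; by hypothesis every Y_{ik} has L^q norm
    O(m^(-1/2)).

    Deterministic part ([eigenvalue_relative_bound]). Fix j and give the
    coordinate i <> j the weight w_i = |lambda_i - lambda_j|, and the
    coordinate j a weight w_j below all of these. If
    X = sum_{i,k} E_{ik}^2 / (w_i w_k) is at most 1/16, then by Cauchy-Schwarz the
    form of E restricted to the coordinates other than j is at most a quarter of
    sum_i w_i f_i^2, and completing the square in the cross terms costs half of
    it plus 2 V f_j^2 with V = sum_{i<>j} E_{ij}^2 / w_i. So the form of the
    perturbed operator lies between the forms of two diagonal ones whose j-th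
    entry is lambda_j + E_{jj} +/- 2 V, while every other entry has moved
    by at most three quarters of its gap and stays on its side. The min-max
    principle gives |lhat_j - lambda_j - I_{jj}| <= 2 V. When X > 1/16 only the
    crude bound lambda_j + 2 |E|_HS is used ([eigenvalue_crude_bound]), multiplied by
    (16 X)^n >= 1.

    Min-max. The eigenvalues are only known to be the successive largest ones
    that have eigenfunctions, so for the lower bound an eigenfunction has to
    be produced. It maximizes the form of the deflated matrix over the unit
    ball of l^2, which is compact in the product topology, where the form of a
    Hilbert-Schmidt matrix is continuous ([hs_max_eigenvector]); the maximizer
    is realized as a function by the completeness of L^2 ([riesz_fischer],
    [min_max_lower]).

    Moments. X, V and |E|_HS^2 are all of the form sum alpha_{ik} Y_{ik}^2 with
    nonnegative weights of total mass A, so their L^r norms are O(A / m) by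
    Minkowski's inequality ([weighted_sqr_moment]). With B = C m^(1/2-a), the gap
    condition gives A = O(B lambda_j) for V, A = O(B^2) for X, and A = O(1) for
    |E|_HS^2. Hence V / lambda_j is O(m^(-a-1/2)) in L^p, which is the
    claimed rate, and X is O(m^(-2a)) in L^(np) with 2 n p = q. Since
    n >= h/a + 1, the factor X^n beats 1 / lambda_j = O(m^h), so the bad event is
    negligible ([relative_error_moment], [rate_le]). Finally the p-th power of a
    maximum is at most the sum of the p-th powers, whence J^(1/p). *)

(** * Quadratic forms on square-summable sequences *)

Section quadratic_forms.
Context (R : realType).
Implicit Types (b : nat -> nat -> R) (c : nat -> R).

Lemma discriminant_le (x y z : R) : 0 <= z ->
  (forall t, 0 <= x - 2 * t * y + t ^+ 2 * z) -> y ^+ 2 <= x * z.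
Proof.
rewrite le_eqVlt => /predU1P[<-|z0] H.
- rewrite mulr0; have [->|y0] := eqVneq y 0; first by rewrite expr0n.
  have := H ((x + 1) / (2 * y)); rewrite mulr0 addr0.
  rewrite (_ : 2 * _ * _ = x + 1); first by lra.
  by field.
- have := H (y / z).
  rewrite (_ : _ + _ = (x * z - y ^+ 2) / z); last by field; rewrite gt_eqF.
  by rewrite pmulr_lge0 ?invr_gt0// subr_ge0.
Qed.

Lemma quadratic_le0 (x y : R) : (forall t, t * x <= t ^+ 2 * y) -> x = 0.
Proof.
move=> H; apply/eqP; rewrite -sqrf_eq0 eq_le sqr_ge0 andbT.
have Y0 : 0 < `|y| + 1 by rewrite ltr_pwDr.
have := H (x / (`|y| + 1)).
rewrite -(ler_pM2r (exprn_gt0 2 Y0)).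
rewrite (_ : _ / _ * x * _ = x ^+ 2 * (`|y| + 1)); last by field; rewrite gt_eqF.
rewrite (_ : _ * y * _ = x ^+ 2 * y); last by field; rewrite gt_eqF.
have := ler_wpM2l (sqr_ge0 x) (ler_norm y).
lra.
Qed.

Definition qform b c N := \sum_(0 <= i < N) \sum_(0 <= j < N) b i j * c i * c j.

Definition hs_sqr b N := \sum_(0 <= i < N) \sum_(0 <= j < N) b i j ^+ 2.

Definition sqr_sum c N := \sum_(0 <= i < N) c i ^+ 2.

Lemma sqr_sum_ge0 c N : 0 <= sqr_sum c N.
Proof. by apply: sumr_ge0 => i _; rewrite sqr_ge0. Qed.

Lemma double_sum_cauchy_schwarz (x y : nat -> nat -> R) N :
  (\sum_(0 <= i < N) \sum_(0 <= j < N) x i j * y i j) ^+ 2 <=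
  hs_sqr x N * hs_sqr y N.
Proof.
apply: discriminant_le.
  by apply: sumr_ge0 => i _; apply: sumr_ge0 => j _; rewrite sqr_ge0.
move=> t.
rewrite (_ : _ + _ = hs_sqr (fun i j => x i j - t * y i j) N).
  by apply: sumr_ge0 => i _; apply: sumr_ge0 => j _; rewrite sqr_ge0.
rewrite /hs_sqr !mulr_sumr -sumrB -big_split/=; apply: eq_bigr => i _.
rewrite !mulr_sumr -sumrB -big_split/=; apply: eq_bigr => j _.
ring.
Qed.

Lemma qform_cauchy_schwarz b c N :
  qform b c N ^+ 2 <= hs_sqr b N * sqr_sum c N ^+ 2.
Proof.
have -> : sqr_sum c N ^+ 2 = hs_sqr (fun i j => c i * c j) N.
  rewrite /sqr_sum expr2 mulr_suml; apply: eq_bigr => i _.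
  by rewrite mulr_sumr; apply: eq_bigr => j _; rewrite exprMn.
rewrite /qform.
under eq_bigr do under eq_bigr do rewrite -mulrA.
exact: double_sum_cauchy_schwarz.
Qed.

Lemma double_sum_truncate (F : nat -> nat -> R) M N : (M <= N)%N ->
  \sum_(0 <= i < M) \sum_(0 <= j < M) F i j =
  \sum_(0 <= i < N) \sum_(0 <= j < N) if (i < M)%N && (j < M)%N then F i j else 0.
Proof.
move=> MN; rewrite (big_nat_widen _ _ N)//= big_mkcond/=.
apply: eq_bigr => i _; case: ltnP => iM /=; last by rewrite big1.
by rewrite (big_nat_widen _ _ N)//= big_mkcond.
Qed.

(** The entries outside the leading M x M block carry the increment, so it is
    controlled by their Hilbert-Schmidt mass. *)
Lemma qform_increment b c T M N : (M <= N)%N -> sqr_sum c N <= T ->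
  (qform b c N - qform b c M) ^+ 2 <= (hs_sqr b N - hs_sqr b M) * T ^+ 2.
Proof.
move=> MN cT.
pose b' i j := if (i < M)%N && (j < M)%N then 0 else b i j.
have -> : qform b c N - qform b c M = qform b' c N.
  rewrite /qform (double_sum_truncate (fun i j => b i j * c i * c j) MN).
  rewrite -sumrB; apply: eq_bigr => i _; rewrite -sumrB; apply: eq_bigr => j _.
  by rewrite /b'; case: ifP => _; ring.
have -> : hs_sqr b N - hs_sqr b M = hs_sqr b' N.
  rewrite /hs_sqr (double_sum_truncate (fun i j => b i j ^+ 2) MN).
  rewrite -sumrB; apply: eq_bigr => i _; rewrite -sumrB; apply: eq_bigr => j _.
  by rewrite /b'; case: ifP => _; ring.
apply: le_trans (qform_cauchy_schwarz _ _ _) _; apply: ler_wpM2l.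
  by apply: sumr_ge0 => i _; apply: sumr_ge0 => j _; rewrite sqr_ge0.
by rewrite ler_sqr ?nnegrE ?sqr_sum_ge0// (le_trans (sqr_sum_ge0 c N)).
Qed.

Lemma sum_nat_delta (F : nat -> R) k N : (k < N)%N ->
  \sum_(0 <= i < N) (i == k)%:R * F i = F k.
Proof.
move=> kN; rewrite (bigD1_seq k) ?mem_index_iota ?iota_uniq//= eqxx mul1r.
by rewrite big1 ?addr0// => i /negbTE ->; rewrite mul0r.
Qed.

Lemma qform_perturb b c t k N : (forall i j, b i j = b j i) -> (k < N)%N ->
  qform b (fun i => c i + t * (i == k)%:R) N =
  qform b c N + 2 * t * \sum_(0 <= i < N) b i k * c i + t ^+ 2 * b k k.
Proof.
move=> sb kN; rewrite /qform.
transitivity (\sum_(0 <= i < N) \sum_(0 <= j < N) (b i j * c i * c j)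
  + t * (\sum_(0 <= i < N) \sum_(0 <= j < N) (j == k)%:R * (b i j * c i))
  + t * (\sum_(0 <= i < N) (i == k)%:R * \sum_(0 <= j < N) (b i j * c j))
  + t ^+ 2 * (\sum_(0 <= i < N) (i == k)%:R * \sum_(0 <= j < N) ((j == k)%:R * b i j))).
  rewrite !mulr_sumr -!big_split/=; apply: eq_bigr => i _.
  rewrite !mulr_sumr -!big_split/=; apply: eq_bigr => j _.
  ring.
rewrite !sum_nat_delta//.
under [X in _ + t * X + _ + _]eq_bigr do rewrite sum_nat_delta//.
under [X in _ + _ + t * X + _]eq_bigr do rewrite sb.
by ring.
Qed.

Lemma hs_sqr_nd b : {homo hs_sqr b : n m / (n <= m)%N >-> n <= m}.
Proof.
move=> n m nm; rewrite /hs_sqr (double_sum_truncate (fun i j => b i j ^+ 2) nm).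
apply: ler_sum => i _; apply: ler_sum => j _.
by case: ifP => // _; rewrite sqr_ge0.
Qed.

Section hilbert_schmidt.
Variables (b : nat -> nat -> R) (B : R).
Hypothesis bB : forall N, hs_sqr b N <= B.

Lemma hs_tail_small (e : R) : 0 < e ->
  exists N0, forall M N, (N0 <= M)%N -> (M <= N)%N -> hs_sqr b N - hs_sqr b M <= e.
Proof.
move=> e0.
have cH : cvgn (hs_sqr b).
  apply: nondecreasing_is_cvgn; first exact: hs_sqr_nd.
  by exists B => _ [n _ <-].
have /cvgrPdist_le/(_ _ e0)[N0 _ N0P] := cH.
exists N0 => M N NM MN.
have HN := nondecreasing_cvgn_le (@hs_sqr_nd b) cH N.
have := le_trans (ler_norm _) (N0P M NM); lra.
Qed.

Lemma qform_cauchy (T e : R) : 0 <= T -> 0 < e -> exists N0, forall c M N,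
  (N0 <= M)%N -> (M <= N)%N -> (forall n, sqr_sum c n <= T) ->
  `|qform b c N - qform b c M| <= e.
Proof.
move=> T0 e0.
have e1 : 0 < e / (T + 1) by rewrite divr_gt0// ltr_wpDl.
have [N0 N0P] := hs_tail_small (exprn_gt0 2 e1).
exists N0 => c M N NM MN cT.
rewrite -ler_sqr ?nnegrE ?(ltW e0)// real_normK ?num_real//.
apply: le_trans (qform_increment b MN (cT N)) _.
apply: (@le_trans _ _ ((e / (T + 1)) ^+ 2 * (T + 1) ^+ 2)).
  apply: ler_pM => //.
  - by rewrite subr_ge0 hs_sqr_nd.
  - by rewrite sqr_ge0.
  - exact: N0P.
  - by rewrite ler_sqr ?nnegrE; lra.
by rewrite -exprMn divfK// gt_eqF// ltr_wpDl.
Qed.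

Lemma qform_cvg c (T : R) : (forall n, sqr_sum c n <= T) -> cvgn (qform b c).
Proof.
move=> cT; have T0 : 0 <= T := le_trans (sqr_sum_ge0 c 0) (cT 0%N).
apply/cauchy_cvgP/cauchy_ballP => e e0.
have e20 : 0 < e / 2 / 2 by rewrite !divr_gt0.
have [N0 N0P] := qform_cauchy T0 e20.
pose tail := [set qform b c n | n in [set n | (N0 <= n)%N]].
exists (tail, tail); first by split; exists N0 => // n /= Nn; exists n.
move=> [_ _] [[m /= Nm <-] [n /= Nn <-]]; rewrite -ball_normE /=.
have := N0P c N0 m (leqnn _) Nm cT; have := N0P c N0 n (leqnn _) Nn cT.
have := ler_normD (qform b c m - qform b c N0) (qform b c N0 - qform b c n).
rewrite addrA subrK (distrC (qform b c N0)).
lra.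
Qed.

(** The truncated forms converge uniformly on balls of l^2, which is what makes
    the limit form weakly continuous. *)
Lemma qform_lim_dist (T e : R) : 0 <= T -> 0 < e -> exists N0, forall c M,
  (N0 <= M)%N -> (forall n, sqr_sum c n <= T) ->
  `|lim (qform b c @ \oo) - qform b c M| <= e.
Proof.
move=> T0 e0; have [N0 N0P] := qform_cauchy T0 e0.
exists N0 => c M NM cT.
have := qform_cvg cT => cq.
have : `|qform b c N - qform b c M| @[N --> \oo] --> `|lim (qform b c @ \oo) - qform b c M|.
  by apply: cvg_norm; apply: cvgB => //; exact: cvg_cst.
move/cvgr_to_le; apply.
by exists M => // N /= MN; exact: N0P.
Qed.

Let l2 := prod_topology (fun _ : nat => R : topologicalType).

Definition l2_ball : set l2 := [set c | forall n, sqr_sum c n <= 1].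

Lemma sqr_le_sqr_sum c k N : (k < N)%N -> c k ^+ 2 <= sqr_sum c N.
Proof.
move=> kN; rewrite /sqr_sum (bigD1_seq k) ?mem_index_iota ?iota_uniq//= lerDl.
by apply: sumr_ge0 => i _; rewrite sqr_ge0.
Qed.

Lemma coord_continuous i : continuous (fun c : l2 => c i).
Proof. exact: (@proj_continuous _ (fun=> R : topologicalType) i). Qed.

Lemma sqr_sum_continuous N : continuous (fun c : l2 => sqr_sum c N).
Proof.
apply: (@continuous_big _ _ +%R 0 xpredT _ _ _ (fun i (c : l2) => c i ^+ 2)).
  exact: add_continuous.
move=> i _ c.
exact: (continuousM (@coord_continuous i c) (@coord_continuous i c)).
Qed.

Lemma qform_continuous N : continuous (fun c : l2 => qform b c N).
Proof.
apply: (@continuous_big _ _ +%R 0 xpredT _ _ _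
  (fun i (c : l2) => \sum_(0 <= j < N) b i j * c i * c j)).
  exact: add_continuous.
move=> i _; apply: (@continuous_big _ _ +%R 0 xpredT _ _ _
  (fun j (c : l2) => b i j * c i * c j)); first exact: add_continuous.
move=> j _ c.
have bc : {for c, continuous (fun _ : l2 => b i j)} by exact: cst_continuous.
exact: (continuousM (continuousM bc (@coord_continuous i c)) (@coord_continuous j c)).
Qed.

(** The product topology makes the unit ball of l^2 compact: this is weak
    compactness, obtained from Tychonoff's theorem. *)
Lemma l2_ball_compact : compact l2_ball.
Proof.
have := @tychonoff nat (fun=> R : topologicalType) (fun=> `[-1, 1]%classic)
  (fun=> @segment_compact R _ _).
move=> cK; apply: (subclosed_compact _ cK).
  rewrite (_ : l2_ball = \bigcap_(n in [set: nat]) [set c : l2 | sqr_sum c n <= 1]).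
    apply: closed_bigI => n _.
    apply: (@preimage_closed _ _ (fun c : l2 => sqr_sum c n) [set x | x <= 1]).
      by move=> x _; exact: sqr_sum_continuous.
    exact: closed_le.
  by apply/seteqP; split => c cn n; [move=> _|]; exact: cn.
move=> c c1 i /=; rewrite in_itv/= -ler_norml.
rewrite -(@expr_le1 _ 2)// real_normK ?num_real//.
exact: le_trans (sqr_le_sqr_sum c (ltnSn i)) (c1 _).
Qed.

Lemma qform_lim_continuous :
  {within l2_ball, continuous (fun c : l2 => lim (qform b c @ \oo))}.
Proof.
have key (x y u v e : R) : `|u - v| <= e / 3 -> `|x - u| <= e / 3 ->
    `|y - v| <= e / 3 -> `|x - y| <= e.
  rewrite !ler_norml => /andP[? ?] /andP[? ?] /andP[? ?].
  apply/andP; split; lra.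
apply/subspace_continuousP => c c1; apply/cvgrPdist_le => e e0.
have e30 : 0 < e / 3 by rewrite divr_gt0.
have [N NP] := qform_lim_dist ler01 e30.
have /cvgrPdist_le/(_ _ e30) cN := @qform_continuous N c.
near=> z.
have z1 : l2_ball z by near: z; exact: withinT.
have zN : `|qform b c N - qform b z N| <= e / 3.
  by near: z; apply: cvg_within; exact: cN.
exact: key zN (NP c N (leqnn N) c1) (NP z N (leqnn N) z1).
Unshelve. all: by end_near. Qed.

Lemma qform0 N : qform b (fun=> 0) N = 0.
Proof. by apply: big1 => i _; apply: big1 => j _; rewrite mulr0. Qed.

Lemma qformZ s c N : qform b (fun i => s * c i) N = s ^+ 2 * qform b c N.
Proof.
rewrite /qform mulr_sumr; apply: eq_bigr => i _.
by rewrite mulr_sumr; apply: eq_bigr => j _; ring.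
Qed.

Lemma sqr_sumZ s c N : sqr_sum (fun i => s * c i) N = s ^+ 2 * sqr_sum c N.
Proof.
by rewrite /sqr_sum mulr_sumr; apply: eq_bigr => i _; rewrite exprMn.
Qed.

Lemma qform_lim_le M c T : (forall z : l2, l2_ball z -> lim (qform b z @ \oo) <= M) ->
  (forall n, sqr_sum c n <= T) -> lim (qform b c @ \oo) <= M * T.
Proof.
move=> HM cT; have : 0 <= T := le_trans (sqr_sum_ge0 c 0) (cT 0%N).
rewrite le_eqVlt => /predU1P[T0|T0].
  rewrite -T0 mulr0 (_ : qform b c = fun=> 0) ?lim_cst//.
  apply/funext => n; apply/eqP; rewrite -sqrf_eq0 eq_le sqr_ge0 andbT.
  apply: le_trans (qform_cauchy_schwarz _ _ _) _.
  have -> : sqr_sum c n = 0 by apply/eqP; rewrite eq_le sqr_sum_ge0 T0 cT.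
  by rewrite expr0n mulr0.
pose s := (Num.sqrt T)^-1.
have s2 : s ^+ 2 = T^-1 by rewrite /s exprVn sqr_sqrtr// ltW.
have z1 : l2_ball (fun i => s * c i).
  by move=> n; rewrite sqr_sumZ s2 mulrC ler_pdivrMr// mul1r.
have := HM _ z1.
rewrite (_ : qform b _ = fun n => T^-1 * qform b c n); last first.
  by apply/funext => n; rewrite qformZ s2.
rewrite (cvg_lim _ (cvgM (cvg_cst T^-1) (qform_cvg cT)))//.
by rewrite mulrC ler_pdivrMr.
Qed.

Lemma sqr_sum_perturb c t k N : (k < N)%N ->
  sqr_sum (fun i => c i + t * (i == k)%:R) N =
  sqr_sum c N + 2 * t * c k + t ^+ 2.
Proof.
move=> kN; transitivity (sqr_sum c N
    + \sum_(0 <= i < N) (i == k)%:R * (2 * t * c i + t ^+ 2)).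
  rewrite /sqr_sum -big_split/=; apply: eq_bigr => i _.
  by case: (i == k); rewrite /=; ring.
by rewrite sum_nat_delta// addrA.
Qed.

Lemma sqr_sum_nd c : {homo sqr_sum c : n m / (n <= m)%N >-> n <= m}.
Proof.
move=> n m nm; rewrite /sqr_sum (@big_cat_nat _ _ _ n 0 m)//= lerDl.
by apply: sumr_ge0 => i _; rewrite sqr_ge0.
Qed.

(** A maximizer of the form over the compact unit ball satisfies the first-order
    condition in every coordinate direction, which is the eigenvalue equation. *)
Lemma hs_max_eigenvector (v : nat -> R) (mu : R) :
  (forall i j, b i j = b j i) -> 0 < mu -> (forall n, sqr_sum v n <= 1) ->
  mu <= lim (qform b v @ \oo) ->
  exists M c, [/\ mu <= M, forall n, sqr_sum c n <= 1, exists k, c k != 0 &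
    forall k, \sum_(0 <= i < N) b i k * c i @[N --> \oo] --> M * c k].
Proof.
move=> sb mu0 v1 muv.
have [|c /[!inE] c1 cmax] := compact_EVT_max _ l2_ball_compact qform_lim_continuous.
  by exists v.
set M := lim (qform b c @ \oo) in cmax.
have muM : mu <= M by apply: le_trans muv _; apply: cmax; rewrite inE.
exists M, c; split => //.
  apply: contrapT => c0; have : 0 < M by exact: lt_le_trans muM.
  rewrite (_ : M = 0) ?ltxx// /M (_ : qform b c = fun=> 0) ?lim_cst//.
  apply/funext => N; rewrite (_ : c = fun=> 0) ?qform0//.
  apply/funext => k; apply/eqP; apply: contrapT => /negP ck.
  by apply: c0; exists k.
move=> k.
have pT t n : sqr_sum (fun i => c i + t * (i == k)%:R) n <= 1 + 2 * t * c k + t ^+ 2.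
  apply: le_trans (sqr_sum_nd _ (leq_addl k.+1 n)) _.
  rewrite sqr_sum_perturb; last by rewrite addSn ltnS leq_addr.
  by rewrite !lerD2r c1.
have cq t := qform_cvg (pT t).
have qM t : lim (qform b (fun i => c i + t * (i == k)%:R) @ \oo) <=
    M * (1 + 2 * t * c k + t ^+ 2).
  by apply: qform_lim_le (pT t) => z z1; apply: cmax; rewrite inE.
pose q1 := lim (qform b (fun i => c i + 1 * (i == k)%:R) @ \oo).
pose l := (q1 - M - b k k) / 2.
have bl : \sum_(0 <= i < N) b i k * c i @[N --> \oo] --> l.
  have : (qform b (fun i => c i + 1 * (i == k)%:R) N - qform b c N - b k k) / 2
      @[N --> \oo] --> l.
    apply: cvgM; last exact: cvg_cst.
    apply: cvgB; last exact: cvg_cst.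
    by apply: cvgB; [exact: cq|exact: qform_cvg c1].
  apply: cvg_trans; apply: near_eq_cvg; exists k.+1 => // N /= kN.
  by rewrite qform_perturb//; field.
suff /eqP : 2 * (l - M * c k) = 0.
  by rewrite mulf_eq0 pnatr_eq0/= subr_eq0 => /eqP <-.
apply: (@quadratic_le0 _ (M - b k k)) => t.
have : lim (qform b (fun i => c i + t * (i == k)%:R) @ \oo) = M + 2 * t * l + t ^+ 2 * b k k.
  apply: cvg_lim => //.
  have : qform b c N + 2 * t * (\sum_(0 <= i < N) b i k * c i) + t ^+ 2 * b k k
      @[N --> \oo] --> M + 2 * t * l + t ^+ 2 * b k k.
    apply: cvgD; last exact: cvg_cst.
    apply: cvgD; first exact: qform_cvg c1.
    by apply: cvgM => //; exact: cvg_cst.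
  apply: cvg_trans; apply: near_eq_cvg; exists k.+1 => // N /= kN.
  by rewrite qform_perturb.
have := qM t; lra.
Qed.

End hilbert_schmidt.

End quadratic_forms.

(** * The Hilbert space L^2 *)

Lemma cvg_le_dist (R : realType) (v u : nat -> R) (l : R) :
  (forall n, `|u n - l| <= v n) -> v n @[n --> \oo] --> 0 ->
  u n @[n --> \oo] --> l.
Proof.
move=> uv v0; apply/subr_cvg0; apply: norm_cvg0.
apply: (@squeeze_cvgr _ _ _ _ (cst 0) v) => //; last exact: cvg_cst.
by apply: nearW => n; rewrite normr_ge0/= uv.
Qed.

Section L2_hilbert.
Context d (X : measurableType d) (R : realType).
Variable mu : {measure set X -> \bar R}.
Implicit Types f g : L2 mu.

Lemma integrable_L2dot f g : mu.-integrable setT (EFin \o (fun x => f x * g x)).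
Proof. by apply/Lfun1_integrable/Lfun2_mul_Lfun1; exact: LfunP. Qed.

Lemma L2dotC f g : L2dot f g = L2dot g f.
Proof. by apply: eq_Rintegral => x _; rewrite mulrC. Qed.

Lemma L2dotDl f g h : L2dot (f + g) h = L2dot f h + L2dot g h.
Proof.
rewrite /L2dot -RintegralD//; try exact: integrable_L2dot.
by apply: eq_Rintegral => x _; rewrite /= mulrDl.
Qed.

Lemma L2dotZl c f g : L2dot (c *: f) g = c * L2dot f g.
Proof.
rewrite /L2dot -RintegralZl//; last exact: integrable_L2dot.
by apply: eq_Rintegral => x _; rewrite /= mulrA.
Qed.

Lemma L2dotDr f g h : L2dot h (f + g) = L2dot h f + L2dot h g.
Proof. by rewrite L2dotC L2dotDl !(L2dotC h). Qed.

Lemma L2dotZr c f g : L2dot g (c *: f) = c * L2dot g f.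
Proof. by rewrite L2dotC L2dotZl (L2dotC g). Qed.

Lemma L2dot0l g : L2dot 0 g = 0.
Proof. by rewrite -(scale0r (0 : L2 mu)) L2dotZl mul0r. Qed.

Lemma L2dotBl f g h : L2dot (f - g) h = L2dot f h - L2dot g h.
Proof. by rewrite -scaleN1r L2dotDl L2dotZl mulN1r. Qed.

Lemma L2dotBr f g h : L2dot h (f - g) = L2dot h f - L2dot h g.
Proof. by rewrite L2dotC L2dotBl !(L2dotC h). Qed.

Lemma L2dot_suml I (r : seq I) (P : pred I) (F : I -> L2 mu) g :
  L2dot (\sum_(i <- r | P i) F i) g = \sum_(i <- r | P i) L2dot (F i) g.
Proof.
elim/big_rec2: _ => [|i x y _ <-]; first exact: L2dot0l.
by rewrite L2dotDl.
Qed.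

Lemma L2dot_sumr I (r : seq I) (P : pred I) (F : I -> L2 mu) g :
  L2dot g (\sum_(i <- r | P i) F i) = \sum_(i <- r | P i) L2dot g (F i).
Proof. by rewrite L2dotC L2dot_suml; apply: eq_bigr => i _; rewrite L2dotC. Qed.

Lemma L2dot_ge0 f : 0 <= L2dot f f.
Proof. by apply: Rintegral_ge0 => x _; rewrite -expr2 sqr_ge0. Qed.

Lemma EFin_L2dot f : (L2dot f f)%:E = (\int[mu]_x ((f x) ^+ 2)%:E)%E.
Proof.
rewrite /L2dot /Rintegral fineK//.
by apply: integrable_fin_num => //; exact: integrable_L2dot.
Qed.

Lemma L2norm_sqr f : L2norm f ^+ 2 = L2dot f f.
Proof.
apply/EFin_inj; rewrite EFin_L2dot.
rewrite (_ : \int[mu]_x _ = \int[mu]_x (`|(EFin \o f) x| `^ 2))%E; last first.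
  apply: eq_integral => x _ /=.
  by rewrite powR_mulrn// real_normK// num_real.
rewrite -powR_Lnorm//.
rewrite -(@fineK _ 'N[mu]_2%:E[EFin \o f]%E); last first.
  by rewrite ge0_fin_numE ?Lnorm_ge0//; exact: Lfunction_finite.
by rewrite poweR_EFin powR_mulrn// fine_ge0// Lnorm_ge0.
Qed.

Lemma L2norm_ge0 f : 0 <= L2norm f.
Proof. by rewrite fine_ge0// Lnorm_ge0. Qed.

Lemma L2_cauchy_schwarz f g : L2dot f g ^+ 2 <= L2dot f f * L2dot g g.
Proof.
apply: discriminant_le => [|t]; first exact: L2dot_ge0.
have := L2dot_ge0 (f - t *: g).
rewrite L2dotBl !L2dotBr !L2dotZl !L2dotZr (L2dotC g f) => h.
by apply: le_trans h _; rewrite le_eqVlt; apply/orP; left; apply/eqP; ring.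
Qed.

Lemma L2_cauchy_schwarz_norm f g : `|L2dot f g| <= L2norm f * L2norm g.
Proof.
rewrite -ler_sqr ?nnegrE ?mulr_ge0 ?L2norm_ge0//.
by rewrite real_normK ?num_real// exprMn !L2norm_sqr L2_cauchy_schwarz.
Qed.

Lemma L2cvg_dot (u : nat -> L2 mu) f g : L2cvg u f ->
  L2dot (u N) g @[N --> \oo] --> L2dot f g.
Proof.
move=> uf; apply: (@cvg_le_dist _ (fun N => L2norm (u N - f) * L2norm g)).
- by move=> N; rewrite -L2dotBl; exact: L2_cauchy_schwarz_norm.
- by rewrite -(mul0r (L2norm g)); apply: cvgM => //; exact: cvg_cst.
Qed.

End L2_hilbert.

Section riesz_fischer.
Context d (X : measurableType d) (R : realType).
Variable mu : {measure set X -> \bar R}.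

Lemma Lfun2_of_sqr_integral (f : X -> R) : measurable_fun setT f ->
  (\int[mu]_x ((f x) ^+ 2)%:E < +oo)%E -> f \in Lfun mu 2%:E.
Proof.
move=> mf foo; rewrite inE; apply/andP; split; rewrite inE//=.
rewrite /finite_norm unlock poweR_lty//.
by under eq_integral do rewrite /= powR_mulrn// real_normK ?num_real//.
Qed.

Lemma limn_einf_le_ub (u : (\bar R)^nat) (l : \bar R) :
  (forall n, (u n <= l)%E) -> (limn_einf u <= l)%E.
Proof.
move=> ul; rewrite limn_einf_lim; apply: lime_le.
  exact: is_cvg_einfs.
apply: nearW => n; apply: le_trans (ul n).
by apply: ereal_inf_lbound; exists n => /=.
Qed.

(** Blocks of squared norm at most 4^-k: weighting the k-th squared block by
    2^k keeps the sum integrable, and 2 |v| <= 2^-k + 2^k v^2 turns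
    its finiteness into absolute convergence at almost every point. *)
Lemma ae_cvg_of_L2_cauchy (u : nat -> L2 mu) :
  (forall k, L2dot (u k.+1 - u k) (u k.+1 - u k) <= 4^-1 ^+ k) ->
  {ae mu, forall x, cvgn (fun k => u k x)}.
Proof.
move=> uc.
pose v k x := u k.+1 x - u k x.
pose F k x : \bar R := (2 ^+ k * (v k x) ^+ 2)%:E.
have mv k : measurable_fun setT (v k) by by apply: measurable_realfun.measurable_funB.
have mF k : measurable_fun setT (F k).
  by apply/measurable_EFinP; apply: measurable_funM => //; exact: measurable_funX.
have F0 k x : (0 <= F k x)%E by rewrite lee_fin mulr_ge0 ?sqr_ge0 ?exprn_ge0//.
have iF : mu.-integrable setT (fun x => \sum_(0 <= k <oo) F k x)%E.
  apply/integrableP; split.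
    by apply: ge0_emeasurable_sum => // k x _ _; exact: F0.
  under eq_integral do rewrite gee0_abs ?nneseries_ge0//.
  rewrite integral_nneseries//.
  apply: (@le_lt_trans _ _ (\sum_(0 <= k <oo) ((2 / (2 ^ (k + 1))%:R)%:E))%E); last first.
    have := @cvg_geometric_eseries_half R 2 0.
    by move/cvg_lim => /(_ (@ereal_hausdorff R)) ->; rewrite ltry.
  apply: lee_nneseries => k _; first by move=> _; exact: integral_ge0.
  under eq_integral do rewrite /F EFinM.
  rewrite ge0_integralZl//; last first.
    by move=> x _; rewrite lee_fin sqr_ge0.
    by apply/measurable_EFinP; exact: measurable_funX.
  have -> : (\int[mu]_x ((v k x) ^+ 2)%:E = (L2dot (u k.+1 - u k) (u k.+1 - u k))%:E)%E.
    by rewrite EFin_L2dot.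
  rewrite -EFinM lee_fin.
  apply: (le_trans (ler_wpM2l _ (uc k))); first by rewrite exprn_ge0.
  rewrite addn1 natrX exprS -exprMn.
  rewrite (_ : 2 * 4^-1 = 2^-1 :> R); last by field.
  by rewrite exprVn invfM mulrA divff// mul1r.
have := integrable_ae measurableT iF.
apply: filterS => x /(_ I) Fx.
have cv : cvgn [normed series (fun k => v k x)].
  apply: nondecreasing_is_cvgn.
    apply/nondecreasing_seqP => n; rewrite /normed_series_of /=.
    by rewrite /series/= big_nat_recr//= lerDl.
  exists (1 + 2^-1 * fine (\sum_(0 <= k <oo) F k x)%E) => _ [n _ <-].
  rewrite /normed_series_of /series/=.
  apply: (@le_trans _ _ (\sum_(0 <= k < n) (2^-1 * 2^-1 ^+ k + 2^-1 * (2 ^+ k * v k x ^+ 2)))).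
    apply: ler_sum => k _.
    have t0 : 0 < 2 ^+ k :> R by rewrite exprn_gt0.
    rewrite exprVn; set t := 2 ^+ k.
    rewrite -(@ler_pM2l _ (2 * t)) ?mulr_gt0//.
    rewrite (_ : _ * (_ + _) = 1 + t ^+ 2 * `|v k x| ^+ 2); last first.
      by rewrite real_normK ?num_real//; field; rewrite gt_eqF.
    rewrite -subr_ge0 (_ : _ - _ = (1 - t * `|v k x|) ^+ 2); last by ring.
    exact: sqr_ge0.
  rewrite big_split/= lerD//.
    have := @geometric_le_lim R n 2^-1 2^-1.
    rewrite /series/= => H; apply: le_trans (H _ _ _) _ => //.
      by rewrite ger0_norm// invf_lt1// ltr1n.
    by rewrite le_eqVlt; apply/orP; left; apply/eqP; field.
  rewrite -mulr_sumr ler_wpM2l//.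
  rewrite -lee_fin fineK// -sumEFin.
  by apply: (@nneseries_lim_ge _ (F ^~ x)) => k _ _; exact: F0.
have := normed_cvg cv.
rewrite (_ : series _ = (fun k => u k x - u 0 x)); last first.
  by apply/funext => n; rewrite /series/= telescope_sumr.
move=> cu; rewrite (_ : (fun k => u k x) = (fun k => u k x - u 0%N x) \+ cst (u 0%N x)).
  by apply: is_cvgD => //; exact: is_cvg_cst.
by apply/funext => k /=; rewrite subrK.
Qed.

(** Fatou's lemma turns the almost everywhere limit into the limit in norm. *)
Lemma L2_complete (u : nat -> L2 mu) :
  (forall k l, (k <= l)%N -> L2dot (u l - u k) (u l - u k) <= 4^-1 ^+ k) ->
  exists f, L2cvg u f.
Proof.
move=> uc.
(* The upper limit is measurable everywhere and is the limit almost everywhere. *)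
pose f0 x := fine (limn_esup (fun k => (u k x)%:E)).
have mu_ k : measurable_fun setT (fun x => u k x) by exact: measurable_funPT.
have mf0 : measurable_fun setT f0.
  apply: (measurableT_comp (fine_measurable measurableT)) => //.
  apply: measurable_fun_limn_esup => k.
  exact/measurable_EFinP.
have uf0 : {ae mu, forall x, u k x @[k --> \oo] --> f0 x}.
  have := ae_cvg_of_L2_cauchy (fun k => uc k k.+1 (leqnSn k)).
  apply: filterS => x cux.
  rewrite /f0 (_ : limn_esup _ = (lim (u k x @[k --> \oo]))%:E)//.
  suff /cvg_limn_einf_sup[_ ->] : (u k x)%:E @[k --> \oo] --> (lim (u k x @[k --> \oo]))%:E by [].
  by apply/cvg_EFin; [exact: nearW|exact: cux].
have mh k : measurable_fun setT (fun x => f0 x - u k x) by exact: measurable_funB.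
have hk k : (\int[mu]_x ((f0 x - u k x) ^+ 2)%:E <= (4^-1 ^+ k)%:E)%E.
  pose g l x : \bar R := ((u (l + k)%N x - u k x) ^+ 2)%:E.
  have mg l : measurable_fun setT (g l).
    by apply/measurable_EFinP; apply: measurable_funX; exact: measurable_funB.
  rewrite (ae_eq_integral (fun x => limn_einf (g ^~ x)))//.
  - apply: le_trans (fatou _ _ _ _) _ => //.
      by move=> l x _; rewrite lee_fin sqr_ge0.
    apply: limn_einf_le_ub => l.
    have := uc k (l + k)%N (leq_addl _ _).
    by rewrite -lee_fin EFin_L2dot.
  - by apply/measurable_EFinP; exact: measurable_funX.
  - rewrite (_ : (fun x => _) = (fun x => - limn_esup (fun l => - g l x))%E).
      apply: measurableT_comp => //; apply: measurable_fun_limn_esup => l.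
      exact: measurableT_comp.
    by apply/funext => x; rewrite -limn_einfN; congr limn_einf; apply/funext => l; rewrite [RHS]oppeK.
  - move: uf0; apply: filterS => x ux _.
    suff /cvg_limn_einf_sup[-> _] : g l x @[l --> \oo] --> ((f0 x - u k x) ^+ 2)%:E by [].
    apply/cvg_EFin; first exact: nearW.
    rewrite (_ : _ \o _ = fun l => (u (l + k)%N x - u k x) * (u (l + k)%N x - u k x)); last first.
      by apply/funext => l.
    have us : u (l + k)%N x @[l --> \oo] --> f0 x.
      by rewrite (cvg_shiftn k (fun l => u l x)).
    by rewrite expr2; apply: cvgM; apply: cvgB => //; exact: cvg_cst.
have Lh0 : (fun x => f0 x - u 0%N x) \in Lfun mu 2%:E.
  apply: Lfun2_of_sqr_integral => //.
  by apply: le_lt_trans (hk 0%N) _; rewrite ltry.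
pose h0 : L2 mu := Lfun_Sub (lee1n 2) Lh0.
exists (u 0%N + h0).
have uh k : L2norm (u k - (u 0%N + h0)) ^+ 2 <= 4^-1 ^+ k.
  rewrite L2norm_sqr -lee_fin EFin_L2dot.
  apply: le_trans (hk k); rewrite le_eqVlt; apply/orP; left; apply/eqP.
  apply: eq_integral => x _; congr EFin.
  rewrite (_ : (u k - (u 0%N + h0)) x = u k x - (u 0%N x + (f0 x - u 0%N x)))//.
  by ring.
rewrite /L2cvg.
apply: (@cvg_le_dist _ (fun k => 2^-1 ^+ k)).
  move=> k; rewrite subr0 ger0_norm ?L2norm_ge0//.
  rewrite -ler_sqr ?nnegrE ?L2norm_ge0 ?exprn_ge0//.
  apply: le_trans (uh k) _; rewrite -exprM mulnC exprM.
  by rewrite (_ : 2^-1 ^+ 2 = 4^-1 :> R)//; field.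
by apply: cvg_expr; rewrite ger0_norm// invf_lt1// ltr1n.
Qed.

End riesz_fischer.

Section orthonormal_expansion.
Context d (X : measurableType d) (R : realType).
Variable mu : {measure set X -> \bar R}.
Implicit Types f g : L2 mu.

Lemma L2dot_ae_eqZ l f g h : f = l \*o g %[ae mu] -> L2dot f h = l * L2dot g h.
Proof.
move=> fg; rewrite -L2dotZl /L2dot /Rintegral; congr fine.
apply: ae_eq_integral => //.
- by case/integrableP: (integrable_L2dot f h).
- by case/integrableP: (integrable_L2dot (l *: g) h).
- by move: fg; apply: filterS => x /(_ I) /= -> _.
Qed.

Lemma L2dot_ae_eq0 f h : f = cst 0 %[ae mu] -> L2dot f h = 0.
Proof.
move=> f0; rewrite -(mul0r (L2dot f h)); apply: L2dot_ae_eqZ.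
by move: f0; apply: filterS => x /(_ I) /= -> _; rewrite mul0r.
Qed.

Lemma L2dot_eq0_ae f : L2dot f f = 0 -> f = cst 0 %[ae mu].
Proof.
rewrite -L2norm_sqr => /eqP; rewrite sqrf_eq0 => /eqP f0.
exact: fine_Lnormr_eq0.
Qed.

Variable e : nat -> L2 mu.

Lemma dot_orthonormal_sum (c : nat -> R) N k : orthonormal_seq e ->
  L2dot (e k) (\sum_(j < N) c j *: e j) = if (k < N)%N then c k else 0.
Proof.
move=> oe; rewrite L2dot_sumr.
under eq_bigr do rewrite L2dotZr oe.
case: ltnP => kN.
  rewrite (bigD1 (Ordinal kN))//= eqxx mulr1 big1 ?addr0// => i ik.
  rewrite (_ : (k == i) = false) ?mulr0//; apply/negbTE.
  by apply: contra ik => /eqP ki; apply/eqP/val_inj.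
apply: big1 => i _; rewrite (_ : (k == i) = false) ?mulr0//.
by apply/negbTE; rewrite gtn_eqF// (leq_trans (ltn_ord i)).
Qed.

Lemma dot_orthonormal_sums (c c' : nat -> R) N : orthonormal_seq e ->
  L2dot (\sum_(j < N) c j *: e j) (\sum_(j < N) c' j *: e j) =
  \sum_(j < N) c j * c' j.
Proof.
move=> oe; rewrite L2dot_suml; apply: eq_bigr => i _.
by rewrite L2dotZl dot_orthonormal_sum// ltn_ord.
Qed.

Lemma dot_orthonormal_tail (c : nat -> R) M N : (M <= N)%N -> orthonormal_seq e ->
  let g := \sum_(j < N) c j *: e j - \sum_(j < M) c j *: e j in
  L2dot g g = \sum_(M <= j < N) c j ^+ 2.
Proof.
move=> MN oe.
pose c' j := if (M <= j)%N then c j else 0.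
have -> : \sum_(j < N) c j *: e j - \sum_(j < M) c j *: e j = \sum_(j < N) c' j *: e j.
  rewrite -!(big_mkord xpredT (fun j => c j *: e j)) -(big_mkord xpredT (fun j => c' j *: e j)) (@big_cat_nat _ _ _ M)//=.
  rewrite addrAC subrr add0r (@big_cat_nat _ _ _ M 0 N)//=.
  rewrite [X in _ = X + _]big_nat [X in _ = X + _]big1 ?add0r; last first.
    by move=> j /andP[_ jM]; rewrite /c' leqNgt jM scale0r.
  by apply: eq_big_nat => j /andP[Mj _]; rewrite /c' Mj.
rewrite /= dot_orthonormal_sums// -(big_mkord xpredT (fun j => c' j * c' j)).
rewrite (@big_cat_nat _ _ _ M 0 N)//= big_nat big1 ?add0r.
  by apply: eq_big_nat => j /andP[Mj _]; rewrite /c' Mj expr2.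
by move=> j /andP[_ jM]; rewrite /c' leqNgt jM mul0r.
Qed.

(** Completeness of L^2 enters only here: square-summable coefficients are the
    coefficients of some function. *)
Lemma riesz_fischer (c : nat -> R) (B : R) : orthonormal_seq e ->
  (forall N, \sum_(0 <= i < N) c i ^+ 2 <= B) ->
  exists f, forall k, L2dot (e k) f = c k.
Proof.
move=> oe cB.
pose s N := \sum_(0 <= i < N) c i ^+ 2.
have sle M N : (M <= N)%N -> s N = s M + \sum_(M <= i < N) c i ^+ 2.
  by move=> MN; rewrite /s (@big_cat_nat _ _ _ M).
have nds : {homo s : n m / (n <= m)%N >-> n <= m}.
  by move=> n m nm; rewrite (sle n m)// lerDl sumr_ge0// => i _; rewrite sqr_ge0.
have cs : cvgn s.
  by apply: nondecreasing_is_cvgn => //; exists B => _ [n _ <-]; exact: cB.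
have sl N : s N <= lim (s @ \oo) by exact: nondecreasing_cvgn_le.
have /choice[n0 n0P] k : exists n0, forall n, (n0 <= n)%N -> lim (s @ \oo) - s n <= 4^-1 ^+ k.
  have e0 : 0 < 4^-1 ^+ k :> R by rewrite exprn_gt0.
  have /cvgrPdist_le/(_ _ e0) [n0 _ n0P] := cs.
  exists n0 => n n0n; apply: le_trans (n0P n n0n).
  exact: ler_norm.
(* Past n0 k, nondecreasing, and unbounded because of the summand k. *)
pose M k := (k + \sum_(0 <= i < k.+1) n0 i)%N.
have MS k : (M k <= M k.+1)%N.
  by rewrite /M [X in (_ <= _ + X)%N]big_nat_recr//=; apply: leq_add => //; exact: leq_addr.
have Mle k l : (k <= l)%N -> (M k <= M l)%N.
  exact: (@homo_leq _ M leq leqnn leq_trans MS).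
have n0M k : (n0 k <= M k)%N.
  by rewrite /M big_nat_recr//= addnA leq_addl.
have [f uf] : exists f, L2cvg (fun k => \sum_(j < M k) c j *: e j) f.
  apply: L2_complete => k l kl.
  rewrite dot_orthonormal_tail ?Mle//.
  have := n0P k (M k) (n0M k).
  by have := sl (M l); rewrite (sle (M k) (M l)) ?Mle//; lra.
exists f => k.
have /cvg_lim := @L2cvg_dot _ _ _ _ _ _ (e k) uf.
move=> /(_ (@Rhausdorff R)); rewrite L2dotC => <-.
apply: cvg_lim => //; apply: cvg_near_cst.
exists k.+1 => // l /= kl; rewrite L2dotC dot_orthonormal_sum//.
by rewrite (leq_trans kl)// /M leq_addr.
Qed.

Hypothesis be : orthonormal_basis e.

Lemma parseval f g :
  \sum_(0 <= i < N) L2dot (e i) f * L2dot (e i) g @[N --> \oo] --> L2dot f g.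
Proof.
have [oe /(_ f) bf] := be.
have := @L2cvg_dot _ _ _ _ _ _ g bf; apply: cvg_trans; apply: near_eq_cvg; apply: nearW => N.
by rewrite L2dot_suml big_mkord; apply: eq_bigr => i _; rewrite L2dotZl.
Qed.

Lemma bessel f N : \sum_(0 <= i < N) L2dot (e i) f ^+ 2 <= L2dot f f.
Proof.
have ff := @parseval f f.
rewrite -(cvg_lim (@Rhausdorff R) ff).
rewrite (eq_bigr (fun i => L2dot (e i) f * L2dot (e i) f))//.
apply: (@nondecreasing_cvgn_le _ (fun N => \sum_(0 <= i < N) L2dot (e i) f * L2dot (e i) f)).
  apply/nondecreasing_seqP => n.
  by rewrite big_nat_recr//= lerDl -expr2 sqr_ge0.
by apply/cvg_ex; exists (L2dot f f).
Qed.

Lemma coords_eq0_ae f : (forall k, L2dot (e k) f = 0) -> f = cst 0 %[ae mu].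
Proof.
move=> f0; apply: L2dot_eq0_ae.
rewrite -(cvg_lim (@Rhausdorff R) (@parseval f f)).
apply: cvg_lim => //; apply: cvg_near_cst; apply: nearW => N.
by apply: big1 => i _; rewrite f0 mul0r.
Qed.

Lemma matrix_operator_dot (a : nat -> nat -> R) (A : L2 mu -> L2 mu) f g :
  matrix_operator e a A ->
  \sum_(0 <= i < N) \sum_(0 <= j < N) a i j * L2dot (e i) f * L2dot (e j) g
    @[N --> \oo] --> L2dot (A f) g.
Proof.
move=> /(_ f) bf.
have := @L2cvg_dot _ _ _ _ _ _ g bf; apply: cvg_trans; apply: near_eq_cvg; apply: nearW => N.
rewrite L2dot_suml big_mkord; apply: eq_bigr => i _.
by rewrite L2dot_suml big_mkord; apply: eq_bigr => j _; rewrite L2dotZl.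
Qed.

End orthonormal_expansion.

(** * The min-max principle *)

Section min_max.
Context d (X : measurableType d) (R : realType).
Variable mu : {measure set X -> \bar R}.
Implicit Types f g : L2 mu.

Lemma exists_nonzero_kernel (G : nat -> nat -> R) j : exists x : nat -> R,
  0 < \sum_(i < j.+1) x i ^+ 2 /\
  forall k, (k < j)%N -> \sum_(i < j.+1) x i * G i k = 0.
Proof.
pose A : 'M[R]_(j.+1, j) := \matrix_(i, k) G i k.
have /rowV0Pn[v /sub_kermxP vA v0] : kermx A != 0.
  by rewrite -mxrank_eq0 mxrank_ker -lt0n subn_gt0 ltnS rank_leq_col.
exists (fun i => v ord0 (inord i)); split.
  have [i vi] : exists i, v ord0 i != 0.
    apply: contrapT => H; case/negP : v0; apply/eqP/rowP => i.
    by rewrite mxE; apply/eqP; apply: contrapT => /negP vi; apply: H; exists i.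
  rewrite (bigD1 i)//= inord_val ltr_pwDl//; last first.
    by apply: sumr_ge0 => k _; rewrite sqr_ge0.
  by rewrite exprn_even_gt0.
move=> k kj; have /rowP/(_ (Ordinal kj)) := vA.
rewrite [RHS in _ = RHS -> _]mxE mxE => H; rewrite -[RHS]H.
by apply: eq_bigr => i _; rewrite mxE inord_val.
Qed.

Lemma cvg_sum_ord (F : nat -> nat -> R) (L : nat -> R) t :
  (forall s, (s < t)%N -> F s N @[N --> \oo] --> L s) ->
  \sum_(s < t) F s N @[N --> \oo] --> \sum_(s < t) L s.
Proof.
elim: t => [|t IH] FL.
  rewrite big_ord0; under eq_fun do rewrite big_ord0.
  exact: cvg_cst.
rewrite big_ord_recr/=; under eq_fun do rewrite big_ord_recr/=.
by apply: cvgD; [apply: IH => s st; apply: FL; rewrite ltnW|exact: FL].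
Qed.

Lemma hs_sqrB_bounded (b c : nat -> nat -> R) :
  (exists B, forall N, hs_sqr b N <= B) -> (exists B, forall N, hs_sqr c N <= B) ->
  exists B, forall N, hs_sqr (fun i k => b i k - c i k) N <= B.
Proof.
move=> [B bB] [C cC]; exists (2 * B + 2 * C) => N.
apply: (@le_trans _ _ (2 * hs_sqr b N + 2 * hs_sqr c N)).
  rewrite /hs_sqr !mulr_sumr -big_split/=; apply: ler_sum => i _.
  rewrite !mulr_sumr -big_split/=; apply: ler_sum => k _.
  by rewrite -subr_ge0 (_ : _ - _ = (b i k + c i k) ^+ 2) ?sqr_ge0//; ring.
by rewrite lerD// ler_pM2l.
Qed.

Variables (e : nat -> L2 mu) (be : orthonormal_basis e).
Variables (a : nat -> nat -> R) (A : L2 mu -> L2 mu).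
Hypothesis Aa : matrix_operator e a A.
Hypothesis sA : self_adjoint A.

Let oe : orthonormal_seq e := be.1.

Lemma matrix_operator_coord f k :
  \sum_(0 <= i < N) a i k * L2dot (e i) f @[N --> \oo] --> L2dot (e k) (A f).
Proof.
rewrite L2dotC; have := @matrix_operator_dot _ _ _ _ _ _ _ f (e k) Aa.
apply: cvg_trans; apply: near_eq_cvg; exists k.+1 => // N /= kN.
apply: eq_bigr => i _.
rewrite -(sum_nat_delta (fun j => a i j * L2dot (e i) f) kN).
by apply: eq_bigr => j _; rewrite oe mulrC.
Qed.

Lemma matrix_operator_entry i k : L2dot (A (e i)) (e k) = a i k.
Proof.
rewrite L2dotC -(cvg_lim (@Rhausdorff R) (@matrix_operator_coord (e i) k)).
apply: cvg_lim => //; apply: cvg_near_cst; exists i.+1 => // N /= iN.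
rewrite -(sum_nat_delta (fun j => a j k) iN).
by apply: eq_bigr => j _; rewrite oe mulrC.
Qed.

Lemma matrix_operator_sym i k : a i k = a k i.
Proof. by rewrite -!matrix_operator_entry sA L2dotC. Qed.

Lemma matrix_operator_qform f :
  qform a (fun i => L2dot (e i) f) N @[N --> \oo] --> L2dot (A f) f.
Proof. exact: matrix_operator_dot. Qed.

Variables (l : nat -> R) (u : nat -> L2 mu).
Hypothesis Alu : ordered_eigensystem A l u.

Let ou : orthonormal_seq u. Proof. by case: Alu. Qed.

Lemma eigenvector_dot j f : L2dot (A f) (u j) = l j * L2dot (u j) f.
Proof.
case: Alu => _ /(_ j)[_ Auj] _.
by rewrite sA L2dotC; exact: L2dot_ae_eqZ.
Qed.

Lemma eigenvalue_noninc i j : (i <= j)%N -> l j <= l i.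
Proof.
have H k : l k.+1 <= l k.
  case: Alu => _ eu /(_ k _ _ (eu k.+1)); apply => i' ik.
  by rewrite ou ltn_eqF// ltnW.
elim: j => [|j IH]; first by rewrite leqn0 => /eqP ->.
rewrite leq_eqVlt => /predU1P[->//|]; rewrite ltnS => /IH.
exact: le_trans.
Qed.

(** Test the lower bound on the eigenvector itself. *)
Lemma eigenvalue_ge M j : (forall f, M * L2dot f f <= L2dot (A f) f) -> M <= l j.
Proof.
by move=> /(_ (u j)); rewrite eigenvector_dot ou eqxx !mulr1.
Qed.

(** The span of the first j + 1 eigenvectors meets the orthogonal complement of
    any j vectors, and there the form is at least the (j+1)-st eigenvalue. *)
Lemma min_max_upper M j :
  (forall f, (forall i, (i < j)%N -> L2dot (e i) f = 0) ->
    L2dot (A f) f <= M * L2dot f f) -> l j <= M.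
Proof.
move=> HM.
have [x [x0 xu]] := exists_nonzero_kernel (fun i k => L2dot (e k) (u i)) j.
pose f := \sum_(i < j.+1) x i *: u i.
have ff : L2dot f f = \sum_(i < j.+1) x i ^+ 2.
  by rewrite /f dot_orthonormal_sums.
have : L2dot (A f) f <= M * L2dot f f.
  apply: HM => k kj; rewrite /f L2dot_sumr -[RHS](xu k kj).
  by apply: eq_bigr => i _; rewrite L2dotZr.
have : l j * L2dot f f <= L2dot (A f) f.
  rewrite ff {2}/f L2dot_sumr mulr_sumr; apply: ler_sum => i _.
  rewrite L2dotZr eigenvector_dot /f dot_orthonormal_sum// ltn_ord.
  rewrite [leRHS](_ : _ = l i * x i ^+ 2); last by ring.
  by rewrite ler_wpM2r ?sqr_ge0// eigenvalue_noninc// -ltnS.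
move=> /le_trans /[apply].
by rewrite ler_pM2r// ff.
Qed.

Definition deflated j i k :=
  a i k - \sum_(t < j) l t * L2dot (e i) (u t) * L2dot (e k) (u t).

Lemma deflated_hs_bounded j : (exists B, forall N, hs_sqr a N <= B) ->
  exists B, forall N, hs_sqr (deflated j) N <= B.
Proof.
move=> aB; elim: j => [|j IH].
  rewrite (_ : deflated 0 = a)//; apply/funext => i; apply/funext => k.
  by rewrite /deflated big_ord0 subr0.
rewrite (_ : deflated j.+1 = fun i k => deflated j i k -
    l j * L2dot (e i) (u j) * L2dot (e k) (u j)); last first.
  apply/funext => i; apply/funext => k.
  by rewrite /deflated big_ord_recr/= opprD addrA.
apply: hs_sqrB_bounded => //; exists (l j ^+ 2) => N.
rewrite (_ : hs_sqr _ _ = l j ^+ 2 * sqr_sum (fun i => L2dot (e i) (u j)) N ^+ 2).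
  rewrite ler_piMr ?sqr_ge0// expr_le1// ?sqr_sum_ge0//.
  by have := bessel be (u j) N; rewrite ou eqxx.
rewrite /hs_sqr /sqr_sum (expr2 (\sum_(0 <= i < N) _)) mulr_suml mulr_sumr.
apply: eq_bigr => i _.
by rewrite !mulr_sumr; apply: eq_bigr => k _; ring.
Qed.

Lemma deflated_qform j f :
  qform (deflated j) (fun i => L2dot (e i) f) N @[N --> \oo] -->
  L2dot (A f) f - \sum_(t < j) l t * L2dot (u t) f ^+ 2.
Proof.
pose F t N := l t * (\sum_(0 <= i < N) L2dot (e i) (u t) * L2dot (e i) f) ^+ 2.
have FL : \sum_(t < j) F t N @[N --> \oo] --> \sum_(t < j) l t * L2dot (u t) f ^+ 2.
  apply: (@cvg_sum_ord F (fun t => l t * L2dot (u t) f ^+ 2)) => t _.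
  apply: cvgM; first exact: cvg_cst.
  have H := @parseval _ _ _ _ _ be (u t) f.
  exact: (cvgM H H).
apply: (cvg_trans _ (cvgB (@matrix_operator_qform f) FL)); apply: near_eq_cvg; apply: nearW => N.
transitivity (qform a (fun i => L2dot (e i) f) N - \sum_(t < j) \sum_(0 <= i < N)
  \sum_(0 <= k < N) l t * L2dot (e i) (u t) * L2dot (e k) (u t) * L2dot (e i) f * L2dot (e k) f).
  congr (_ - _); apply: eq_bigr => t _; rewrite /F expr2 mulr_suml mulr_sumr.
  by apply: eq_bigr => i _; rewrite !mulr_sumr; apply: eq_bigr => k _; ring.
rewrite exchange_big/= /qform -sumrB; apply: eq_bigr => i _.
rewrite exchange_big/= -sumrB; apply: eq_bigr => k _.
by rewrite /deflated !mulrBl !mulr_suml.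
Qed.

Lemma deflated_coord j f k :
  \sum_(0 <= i < N) deflated j i k * L2dot (e i) f @[N --> \oo] -->
  L2dot (e k) (A f) - \sum_(t < j) l t * L2dot (u t) f * L2dot (e k) (u t).
Proof.
pose F t N := l t * (\sum_(0 <= i < N) L2dot (e i) (u t) * L2dot (e i) f) * L2dot (e k) (u t).
have FL : \sum_(t < j) F t N @[N --> \oo] -->
    \sum_(t < j) l t * L2dot (u t) f * L2dot (e k) (u t).
  apply: (@cvg_sum_ord F (fun t => l t * L2dot (u t) f * L2dot (e k) (u t))) => t _.
  apply: cvgM; last exact: cvg_cst.
  apply: cvgM; first exact: cvg_cst.
  exact: parseval.
apply: (cvg_trans _ (cvgB (@matrix_operator_coord f k) FL)); apply: near_eq_cvg; apply: nearW => N.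
transitivity (\sum_(0 <= i < N) a i k * L2dot (e i) f - \sum_(t < j) \sum_(0 <= i < N)
  l t * L2dot (e i) (u t) * L2dot (e k) (u t) * L2dot (e i) f).
  congr (_ - _); apply: eq_bigr => t _; rewrite /F mulr_sumr mulr_suml.
  by apply: eq_bigr => i _; ring.
rewrite exchange_big/= -sumrB; apply: eq_bigr => i _.
by rewrite /deflated mulrBl !mulr_suml.
Qed.

(** If the form is at least M > 0 on the span of the first j + 1 basis vectors,
    then it is at least M at some unit vector orthogonal to the first j
    eigenvectors, hence the operator deflated by those has an eigenvalue at least
    M. Its eigenfunction is orthogonal to them, so it competes for the
    (j+1)-st eigenvalue. *)
Lemma min_max_lower M j : (exists B, forall N, hs_sqr a N <= B) -> 0 < M ->
  (forall f, (forall i, (j < i)%N -> L2dot (e i) f = 0) ->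
    M * L2dot f f <= L2dot (A f) f) -> M <= l j.
Proof.
move=> aB M0 HM.
have [x [x0 xu]] := exists_nonzero_kernel (fun i k => L2dot (u k) (e i)) j.
pose s := (Num.sqrt (\sum_(i < j.+1) x i ^+ 2))^-1.
pose f := \sum_(i < j.+1) (s * x i) *: e i.
have ff : L2dot f f = 1.
  rewrite /f (dot_orthonormal_sums (fun i => s * x i) (fun i => s * x i))//.
  under eq_bigr do rewrite -expr2 exprMn.
  by rewrite -mulr_sumr /s exprVn sqr_sqrtr ?mulVf ?gt_eqF// ltW.
have fu k : (k < j)%N -> L2dot (u k) f = 0.
  move=> kj; rewrite /f L2dot_sumr -[RHS](mulr0 s) -[X in _ = s * X](xu k kj) mulr_sumr.
  by apply: eq_bigr => i _; rewrite L2dotZr mulrA.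
have MAf : M <= L2dot (A f) f.
  have := HM f; rewrite ff mulr1; apply => i ji.
  by rewrite /f (dot_orthonormal_sum (fun i => s * x i))// ltnS leqNgt ji.
have [B bB] := deflated_hs_bounded j aB.
have bS i k : deflated j i k = deflated j k i.
  rewrite /deflated matrix_operator_sym; congr (_ - _).
  by apply: eq_bigr => t _; rewrite mulrAC.
have [||M' [c [MM' c1 [k0 ck0] cE]]] :=
  @hs_max_eigenvector R _ B bB (fun i => L2dot (e i) f) M bS M0.
- by move=> n; rewrite -ff; exact: bessel.
- rewrite (cvg_lim _ (@deflated_qform j f))// big1 ?subr0// => t _.
  by rewrite fu// expr0n mulr0.
have [g gc] := riesz_fischer oe c1.
have Ag k : L2dot (e k) (A g) =
    M' * L2dot (e k) g + \sum_(t < j) l t * L2dot (u t) g * L2dot (e k) (u t).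
  apply/eqP; rewrite -subr_eq; apply/eqP.
  rewrite -(cvg_lim (@Rhausdorff R) (@deflated_coord j g k)).
  apply: cvg_lim => //; rewrite gc; under eq_fun do under eq_bigr do rewrite gc.
  exact: cE.
have gu s' : (s' < j)%N -> L2dot (u s') g = 0.
  move=> sj.
  pose h := A g - (M' *: g + \sum_(t < j) (l t * L2dot (u t) g) *: u t).
  have h0 : h = cst 0 %[ae mu].
    apply: (coords_eq0_ae be) => k.
    rewrite /h L2dotBr L2dotDr L2dotZr L2dot_sumr Ag.
    by under [X in _ - (_ + X)]eq_bigr do rewrite L2dotZr; rewrite subrr.
  have := L2dot_ae_eq0 (u s') h0.
  rewrite /h L2dotBl L2dotDl L2dotZl (L2dotC (\sum_(t < j) _)).
  rewrite (dot_orthonormal_sum (fun t => l t * L2dot (u t) g))// sj.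
  rewrite eigenvector_dot (L2dotC g) => H.
  have : M' * L2dot (u s') g = 0 by lra.
  by move/eqP; rewrite mulf_eq0 gt_eqF ?(lt_le_trans M0)//= => /eqP.
apply: le_trans MM' _.
case: Alu => _ _; apply; last exact: gu.
split.
  move=> g0; move: ck0; rewrite -gc L2dotC (L2dot_ae_eq0 _ g0).
  by rewrite eqxx.
have : A g - M' *: g = cst 0 %[ae mu].
  apply: (coords_eq0_ae be) => k.
  rewrite L2dotBr L2dotZr Ag big1 ?addr0 ?subrr// => t _.
  by rewrite gu// mulr0 mul0r.
apply: filterS => y /(_ I) H _; apply/eqP; rewrite -subr_eq0; apply/eqP.
exact: H.
Qed.

End min_max.

(** * Deterministic perturbation bounds *)

Section relative_bounds.
Context (R : realType).
Implicit Types (E : nat -> nat -> R) (c w lam : nat -> R).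

(** Cauchy-Schwarz after rescaling the i-th coordinate by the square root of w_i. *)
Lemma qform_weighted E w c N K : (forall i, 0 < w i) -> 0 <= K ->
  \sum_(0 <= i < N) \sum_(0 <= k < N) E i k ^+ 2 / (w i * w k) <= K ^+ 2 ->
  `|qform E c N| <= K * \sum_(0 <= i < N) w i * c i ^+ 2.
Proof.
move=> w0 K0 EK.
have sw i : Num.sqrt (w i) ^+ 2 = w i by rewrite sqr_sqrtr// ltW.
have sw0 i : Num.sqrt (w i) != 0 by rewrite gt_eqF// sqrtr_gt0.
pose E' i k := E i k / (Num.sqrt (w i) * Num.sqrt (w k)).
pose c' i := Num.sqrt (w i) * c i.
have -> : qform E c N = qform E' c' N.
  apply: eq_bigr => i _; apply: eq_bigr => k _.
  by rewrite /E' /c'; field; rewrite !sw0.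
have -> : \sum_(0 <= i < N) w i * c i ^+ 2 = sqr_sum c' N.
  by apply: eq_bigr => i _; rewrite exprMn sw.
rewrite -ler_sqr ?nnegrE ?mulr_ge0 ?sqr_sum_ge0//.
rewrite real_normK ?num_real// exprMn.
apply: le_trans (qform_cauchy_schwarz _ _ _) _.
rewrite ler_wpM2r ?sqr_ge0//; apply: le_trans EK.
rewrite le_eqVlt; apply/orP; left; apply/eqP.
apply: eq_bigr => i _; apply: eq_bigr => k _.
by rewrite /E' expr_div_n exprMn !sw.
Qed.

(** Completing the square with parameter 1/2, coordinate by coordinate. *)
Lemma cross_term_le E w c t j N : (forall i, 0 < w i) -> c j = 0 ->
  `|2 * t * \sum_(0 <= i < N) E i j * c i| <=
  t ^+ 2 * (2 * \sum_(0 <= i < N | i != j) E i j ^+ 2 / w i) +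
  2^-1 * \sum_(0 <= i < N) w i * c i ^+ 2.
Proof.
move=> w0 cj.
have key i : `|2 * t * (E i j * c i)| <=
    t ^+ 2 * (2 * (E i j ^+ 2 / w i)) + 2^-1 * (w i * c i ^+ 2).
  have -> : t ^+ 2 * (2 * (E i j ^+ 2 / w i)) + 2^-1 * (w i * c i ^+ 2) =
      (2 * w i)^-1 * ((2 * t * E i j) ^+ 2 + (w i * c i) ^+ 2).
    by field; rewrite gt_eqF.
  rewrite ler_pdivlMl ?mulr_gt0// -[X in X * `|_|]gtr0_norm ?mulr_gt0// -normrM.
  rewrite ler_norml; apply/andP; split; rewrite -subr_ge0.
    rewrite (_ : _ - _ = (2 * t * E i j + w i * c i) ^+ 2) ?sqr_ge0//; ring.
  by rewrite (_ : _ - _ = (2 * t * E i j - w i * c i) ^+ 2) ?sqr_ge0//; ring.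
rewrite !mulr_sumr (big_mkcond (fun i => i != j))/= -big_split/=.
apply: le_trans (ler_norm_sum _ _ _) _; apply: ler_sum => i _.
case: eqVneq => [->|_] /=; last exact: key.
by rewrite cj expr0n !mulr0 addr0 normr0.
Qed.

Lemma entry_le_double_sum (F : nat -> nat -> R) j N :
  (forall i k, 0 <= F i k) -> (j < N)%N ->
  F j j <= \sum_(0 <= i < N) \sum_(0 <= k < N) F i k.
Proof.
move=> F0 jN; rewrite (bigD1_seq j) ?mem_index_iota ?iota_uniq//=.
rewrite ler_wpDr//; first by apply: sumr_ge0 => i _; exact: sumr_ge0.
rewrite (bigD1_seq j) ?mem_index_iota ?iota_uniq//= ler_wpDr//.
exact: sumr_ge0.
Qed.

End relative_bounds.

Section eigenvalue_perturbation.
Context d (X : measurableType d) (R : realType).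
Variable mu : {measure set X -> \bar R}.
Implicit Types f : L2 mu.
Variables (e : nat -> L2 mu) (be : orthonormal_basis e).
Variables (a : nat -> nat -> R) (A : L2 mu -> L2 mu).
Hypothesis Aa : matrix_operator e a A.
Hypothesis sA : self_adjoint A.
Variables (l : nat -> R) (u : nat -> L2 mu).
Hypothesis Alu : ordered_eigensystem A l u.
Variable lam : nat -> R.
Hypothesis lam_noninc : forall i j, (i <= j)%N -> lam j <= lam i.

Let E i k := a i k - (i == k)%:R * lam i.

Let E_sym i k : E i k = E k i.
Proof.
rewrite /E (matrix_operator_sym be Aa sA) eq_sym.
by case: eqVneq => [->|_]; rewrite ?mul0r.
Qed.

Let qform_split c N :
  qform a c N = \sum_(0 <= i < N) lam i * c i ^+ 2 + qform E c N.
Proof.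
rewrite /qform -big_split/= big_nat [RHS]big_nat; apply: eq_bigr => i /= iN.
rewrite (_ : lam i * c i ^+ 2 = \sum_(0 <= k < N) (k == i)%:R * (lam i * c i * c k)); last first.
  by rewrite sum_nat_delta// expr2 mulrA.
rewrite -big_split/=; apply: eq_bigr => k _.
by rewrite /E eq_sym; ring.
Qed.

Let form_le f M : (\forall N \near \oo,
    qform a (fun i => L2dot (e i) f) N <= M * sqr_sum (fun i => L2dot (e i) f) N) ->
  L2dot (A f) f <= M * L2dot f f.
Proof.
move=> H; have H1 : M * (\sum_(0 <= i < N) L2dot (e i) f * L2dot (e i) f) @[N --> \oo]
    --> M * L2dot f f by apply: cvgM; [exact: cvg_cst|exact: parseval].
have H2 := @matrix_operator_qform _ _ _ _ _ _ _ Aa f.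
apply: (ler_cvg_to H2 H1).
by move: H; apply: filterS => N; rewrite /sqr_sum; under eq_bigr do rewrite expr2.
Qed.

Let form_ge f M : (\forall N \near \oo,
    M * sqr_sum (fun i => L2dot (e i) f) N <= qform a (fun i => L2dot (e i) f) N) ->
  M * L2dot f f <= L2dot (A f) f.
Proof.
move=> H; have H1 : M * (\sum_(0 <= i < N) L2dot (e i) f * L2dot (e i) f) @[N --> \oo]
    --> M * L2dot f f by apply: cvgM; [exact: cvg_cst|exact: parseval].
have H2 := @matrix_operator_qform _ _ _ _ _ _ _ Aa f.
apply: (ler_cvg_to H1 H2).
by move: H; apply: filterS => N; rewrite /sqr_sum; under eq_bigr do rewrite expr2.
Qed.

(** With h the Hilbert-Schmidt norm of the perturbation, its form is at most h
    in absolute value on unit vectors. The lower bound uses only that every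
    eigenvalue is at least -h, whence the extra lambda_j. *)
Lemma eigenvalue_crude_bound j h : (forall i, 0 <= lam i) -> 0 <= h ->
  (forall N, hs_sqr E N <= h ^+ 2) -> `|l j - lam j - E j j| <= lam j + 2 * h.
Proof.
move=> lam0 h0 Eh.
have qE c N : `|qform E c N| <= h * sqr_sum c N.
  rewrite (_ : sqr_sum c N = \sum_(0 <= i < N) 1 * c i ^+ 2); last first.
    by apply: eq_bigr => i _; rewrite mul1r.
  apply: (@qform_weighted R E (fun=> 1) c N h (fun=> ltr01) h0).
  apply: le_trans (Eh N); apply: ler_sum => i _; apply: ler_sum => k _.
  by rewrite mulr1 divr1.
have Ejj : `|E j j| <= h.
  rewrite -ler_sqr ?nnegrE// real_normK ?num_real//; apply: le_trans (Eh j.+1).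
  by apply: (@entry_le_double_sum _ (fun i k => E i k ^+ 2)) => // i k; rewrite sqr_ge0.
have up : l j <= lam j + h.
  apply: (min_max_upper (e := e) sA Alu) => f f0; apply: form_le; apply: nearW => N.
  set c := fun i => L2dot (e i) f.
  rewrite qform_split mulrDl lerD//; last by rewrite (le_trans (ler_norm _)).
  rewrite mulr_sumr; apply: ler_sum => i _; case: (ltnP i j) => ij.
    by rewrite /c f0// expr0n !mulr0.
  by rewrite ler_wpM2r ?sqr_ge0// lam_noninc.
have lo : - h <= l j.
  apply: (eigenvalue_ge sA Alu) => f; apply: form_ge; apply: nearW => N.
  set c := fun i => L2dot (e i) f.
  have : 0 <= \sum_(0 <= i < N) lam i * c i ^+ 2.
    by apply: sumr_ge0 => i _; rewrite mulr_ge0 ?sqr_ge0.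
  have := qE c N; rewrite qform_split ler_norml => /andP[+ _].
  by rewrite mulNr; lra.
have lamj := lam0 j; move: Ejj; rewrite !ler_norml => /andP[? ?].
apply/andP; split; lra.
Qed.

(** Relative bound: measured by the weights w (the distances to the j-th
    eigenvalue), the perturbation is small, so that completing the square in
    the cross terms costs only a fixed fraction of every gap. *)
Lemma eigenvalue_relative_bound j w V : (exists B, forall N, hs_sqr a N <= B) ->
  (forall i, 0 < w i) -> (forall i, i != j -> w i = `|lam j - lam i|) ->
  (forall i, w j <= w i) -> w j <= lam j ->
  (forall N, \sum_(0 <= i < N) \sum_(0 <= k < N) E i k ^+ 2 / (w i * w k) <= 4^-1 ^+ 2) ->
  (forall N, \sum_(0 <= i < N | i != j) E i j ^+ 2 / w i <= V) ->
  `|l j - lam j - E j j| <= 2 * V.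
Proof.
move=> aB w0 wE wj wlam EX EV0.
have EW0 i k : 0 <= E i k ^+ 2 / (w i * w k).
  by rewrite divr_ge0 ?sqr_ge0// mulr_ge0// ltW.
(* The column of E at j is part of X, so V can be lowered to w_j / 16; this
   makes the lower bound lambda_j + E_jj - 2 V positive, as the lower half of
   the min-max principle requires. *)
wlog VW : V EV0 / V <= w j / 16.
  move=> H; have [VW|VW] := leP V (w j / 16); first exact: H.
  apply: le_trans (H (w j / 16) _ (lexx _)) _ => [N|]; last by rewrite ler_pM2l// ltW.
  rewrite (_ : w j / 16 = w j * 4^-1 ^+ 2); last by field.
  apply: le_trans (ler_wpM2l (ltW (w0 j)) (EX (N + j.+1)%N)).
  rewrite mulr_sumr; apply: (@le_trans _ _ (\sum_(0 <= i < N) E i j ^+ 2 / w i)).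
    rewrite big_mkcond/=; apply: ler_sum => i _.
    by case: ifP => // _; rewrite divr_ge0 ?sqr_ge0// ltW.
  rewrite [leRHS](@big_cat_nat _ _ _ N)//= ?leq_addr// ler_wpDr//.
    apply: sumr_ge0 => i _; rewrite mulr_ge0 ?(ltW (w0 j))//.
    by apply: sumr_ge0 => k _; rewrite EW0.
  apply: ler_sum => i _; rewrite (bigD1_seq j) ?mem_index_iota ?iota_uniq//=; last first.
    by rewrite addnS ltnS leq_addl.
  rewrite mulrDr ler_wpDr//; last first.
    rewrite le_eqVlt; apply/orP; left; apply/eqP; field.
    by rewrite !gt_eqF.
  by rewrite mulr_ge0 ?(ltW (w0 j))// sumr_ge0.
have Ejj : `|E j j| <= w j / 4.
  rewrite -ler_sqr ?nnegrE ?divr_ge0 ?(ltW (w0 j))// real_normK ?num_real//.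
  have := le_trans (@entry_le_double_sum _ _ j _ EW0 (ltnSn j)) (EX j.+1).
  rewrite ler_pdivrMr ?mulr_gt0//.
  by rewrite expr_div_n exprVn -expr2 mulrC.
(* The part of c orthogonal to the j-th coordinate direction. *)
pose c' (c : nat -> R) i := if i == j then 0 else c i.
have cE c : c = fun i => c' c i + c j * (i == j)%:R.
  by apply/funext => i; rewrite /c'; case: eqVneq => [->|_] /=; ring.
have qE c N : (j < N)%N -> `|qform E c N - c j ^+ 2 * E j j| <=
    c j ^+ 2 * (2 * V) + 3 / 4 * \sum_(0 <= i < N) w i * c' c i ^+ 2.
  move=> jN; rewrite [X in qform E X N]cE qform_perturb//.
  rewrite addrK.
  have cj0 : c' c j = 0 by rewrite /c' eqxx.
  have K0 : 0 <= 4^-1 :> R by [].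
  have H1 := qform_weighted (c' c) w0 K0 (EX N).
  have H2 := @cross_term_le R E w (c' c) (c j) j N w0 cj0.
  have H3 : c j ^+ 2 * (2 * \sum_(0 <= i < N | i != j) E i j ^+ 2 / w i) <= c j ^+ 2 * (2 * V).
    by rewrite ler_wpM2l ?sqr_ge0// ler_pM2l.
  apply: le_trans (ler_normD _ _) _.
  move: H1 H2 H3; lra.
have cS c N : (j < N)%N -> sqr_sum c N = sqr_sum (c' c) N + c j ^+ 2.
  move=> jN; rewrite [X in sqr_sum X N]cE sqr_sum_perturb//.
  by rewrite (_ : c' c j = 0) ?mulr0 ?addr0// /c' eqxx.
have lamS c N : (j < N)%N -> \sum_(0 <= i < N) lam i * c i ^+ 2 =
    \sum_(0 <= i < N) lam i * c' c i ^+ 2 + lam j * c j ^+ 2.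
  move=> jN; rewrite -(sum_nat_delta (fun i => lam i * c i ^+ 2) jN) -big_split/=.
  apply: eq_bigr => i _; rewrite /c'.
  by case: eqVneq => _ /=; ring.
have wj0 := w0 j.
have up : l j <= lam j + E j j + 2 * V.
  apply: (min_max_upper (e := e) sA Alu) => f f0; apply: form_le; exists j.+1 => // N /= jN.
  set c := fun i => L2dot (e i) f.
  rewrite qform_split lamS// cS//.
  have := qE c N jN; rewrite ler_norml => /andP[_].
  have : \sum_(0 <= i < N) lam i * c' c i ^+ 2 + 3 / 4 * \sum_(0 <= i < N) w i * c' c i ^+ 2
      <= (lam j + E j j + 2 * V) * sqr_sum (c' c) N.
    rewrite !mulr_sumr -big_split/=; apply: ler_sum => i _.
    rewrite [leLHS](_ : _ = (lam i + 3 / 4 * w i) * c' c i ^+ 2); last by ring.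
    have [ij|ij|->] := ltngtP i j.
    - by rewrite /c' ltn_eqF// /c f0// expr0n !mulr0.
    (* Three quarters of the gap are spent; the last quarter covers E_jj. *)
    - rewrite ler_wpM2r ?sqr_ge0//.
      have := wj i; rewrite (wE i) ?gtn_eqF// ger0_norm; last by rewrite subr_ge0 lam_noninc// ltnW.
      move: Ejj; rewrite ler_norml => /andP[? ?].
      have : 0 <= V by have := EV0 0%N; rewrite big_geq.
      lra.
    - by rewrite /c' eqxx expr0n !mulr0.
  lra.
have lo : lam j + E j j - 2 * V <= l j.
  apply: (min_max_lower be Aa sA Alu aB) => [|f f0].
    by move: Ejj; rewrite ler_norml => /andP[? ?]; lra.
  apply: form_ge; exists j.+1 => // N /= jN.
  set c := fun i => L2dot (e i) f.
  rewrite qform_split lamS// cS//.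
  have := qE c N jN; rewrite ler_norml => /andP[+ _].
  have : (lam j + E j j - 2 * V) * sqr_sum (c' c) N <=
     \sum_(0 <= i < N) lam i * c' c i ^+ 2 - 3 / 4 * \sum_(0 <= i < N) w i * c' c i ^+ 2.
    rewrite !mulr_sumr -sumrB; apply: ler_sum => i _.
    rewrite [leRHS](_ : _ = (lam i - 3 / 4 * w i) * c' c i ^+ 2); last by ring.
    have [ij|ij|->] := ltngtP i j.
    - rewrite ler_wpM2r ?sqr_ge0//.
      have := wj i; rewrite (wE i) ?ltn_eqF// distrC ger0_norm; last by rewrite subr_ge0 lam_noninc// ltnW.
      move: Ejj; rewrite ler_norml => /andP[? ?].
      have : 0 <= V by have := EV0 0%N; rewrite big_geq.
      lra.
    - by rewrite /c' gtn_eqF// /c f0// expr0n !mulr0.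
    - by rewrite /c' eqxx expr0n !mulr0.
  lra.
by rewrite ler_norml; apply/andP; split; lra.
Qed.

End eigenvalue_perturbation.

(** * Moments of weighted sums of squares *)

Section moments.
Context d (T : measurableType d) (R : realType).
Variable P : {measure set T -> \bar R}.
Implicit Types f g : T -> R.

Local Notation norm p f := (Lnorm P p%:E (EFin \o f)).

Lemma Lnorm_leP f (p K : R) : 0 < p -> 0 <= K ->
  (norm p (f)%R <= K%:E)%E <-> (\int[P]_x (`|f x| `^ p)%:E <= (K `^ p)%:E)%E.
Proof.
move=> p0 K0.
have -> : (\int[P]_x (`|f x| `^ p)%:E = norm p (f)%R `^ p)%E.
  by rewrite poweR_Lnorm ?gt_eqF//.
have N0 := Lnorm_ge0 P p%:E (EFin \o f).
split => [H|H].
  rewrite -poweR_EFin; apply: gt0_ler_poweR => //; first exact: ltW.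
  - by rewrite in_itv/= N0 leey.
  - by rewrite in_itv/= lee_fin K0 leey.
have -> : norm p (f)%R = ((norm p (f)%R `^ p) `^ p^-1)%E.
  by rewrite -poweRrM mulfV ?gt_eqF// poweRe1.
have -> : K%:E = (((K `^ p)%:E) `^ p^-1)%E.
  by rewrite poweR_EFin -powRrM mulfV ?gt_eqF// powRr1.
apply: gt0_ler_poweR => //; first by rewrite invr_ge0 ltW.
- by rewrite in_itv/= leey poweR_ge0.
- by rewrite in_itv/= lee_fin powR_ge0 leey.
Qed.

Lemma measurable_normpowR f p : measurable_fun setT f ->
  measurable_fun setT (fun x => (`|f x| `^ p)%:E).
Proof.
move=> mf; apply/measurable_EFinP.
apply: (@measurableT_comp _ _ _ _ _ _ (@powR R ^~ p)) => //.
exact: measurableT_comp.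
Qed.

Lemma Lnorm_ae_le f g (p K : R) : 0 < p -> 0 <= K ->
  measurable_fun setT f -> measurable_fun setT g ->
  {ae P, forall x, `|f x| <= `|g x|} ->
  (norm p (g)%R <= K%:E -> norm p (f)%R <= K%:E)%E.
Proof.
move=> p0 K0 mf mg fg /(Lnorm_leP _ p0 K0) gK; apply/(Lnorm_leP _ p0 K0).
apply: le_trans gK; apply: ae_ge0_le_integral => //.
- exact: measurable_normpowR.
- exact: measurable_normpowR.
- move: fg; apply: filterS => x fgx _.
  by rewrite lee_fin ge0_ler_powR ?nnegrE// ltW.
Qed.

Lemma LnormD_le f g (p K L : R) : 1 <= p -> measurable_fun setT f ->
  measurable_fun setT g -> (norm p (f)%R <= K%:E)%E -> (norm p (g)%R <= L%:E)%E ->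
  (norm p (fun x => (f x + g x)%R)%R <= (K + L)%:E)%E.
Proof.
move=> p1 mf mg fK gL; apply: le_trans (minkowski_EFin _ mf mg p1) _.
by rewrite EFinD leeD.
Qed.

Lemma LnormZ_le f (p K c : R) : 0 < p -> 0 <= c -> 0 <= K -> measurable_fun setT f ->
  (norm p (f)%R <= K%:E)%E -> (norm p (fun x => c * f x)%R <= (c * K)%:E)%E.
Proof.
move=> p0 c0 K0 mf /(Lnorm_leP _ p0 K0) fK; apply/Lnorm_leP => //; first exact: mulr_ge0.
under eq_integral do rewrite normrM (ger0_norm c0) powRM// EFinM.
rewrite ge0_integralZl_EFin ?powR_ge0//.
- by rewrite powRM// EFinM; apply: lee_wpmul2l => //; rewrite lee_fin powR_ge0.
- exact: measurable_normpowR.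
Qed.

Lemma Lnorm_sum_le I (s : seq I) (F : I -> T -> R) (K : I -> R) (p : R) : 1 <= p ->
  (forall i, measurable_fun setT (F i)) -> (forall i, (norm p (F i)%R <= (K i)%:E)%E) ->
  (norm p (fun x => \sum_(i <- s) F i x)%R <= (\sum_(i <- s) K i)%:E)%E.
Proof.
move=> p1 mF FK; elim: s => [|i s IH].
  rewrite big_nil; under eq_fun do rewrite big_nil.
  rewrite (_ : EFin \o _ = cst 0)//= Lnorm0// eqe gt_eqF// (lt_le_trans ltr01)//.
rewrite big_cons; under eq_fun do rewrite big_cons.
by apply: LnormD_le => //; exact: measurable_sum.
Qed.

Lemma LnormX_le f (n : nat) (p K : R) : 0 < p -> (0 < n)%N -> 0 <= K ->
  (norm (n%:R * p)%R (f)%R <= K%:E)%E -> (norm p (fun x => f x ^+ n)%R <= (K ^+ n)%:E)%E.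
Proof.
move=> p0 n0 K0; have np0 : 0 < n%:R * p by rewrite mulr_gt0// ltr0n.
move=> /(Lnorm_leP _ np0 K0) fK; apply/Lnorm_leP; rewrite ?exprn_ge0//.
rewrite -powR_mulrn// -powRrM; apply: le_trans fK.
by under eq_integral do rewrite normrX -powR_mulrn// -powRrM.
Qed.

(** Monotone convergence for the p-th powers provides an integrable
    majorant of the whole sequence. *)
Lemma sup_moment (G : nat -> T -> R) (p K : R) : 0 < p -> 0 <= K ->
  (forall N, measurable_fun setT (G N)) -> (forall N x, 0 <= G N x) ->
  (forall x, {homo G ^~ x : n m / (n <= m)%N >-> n <= m}) ->
  (forall N, (norm p (G N)%R <= K%:E)%E) ->
  exists g, [/\ measurable_fun setT g, forall x, 0 <= g x,
    {ae P, forall x, forall N, G N x <= g x} & (norm p (g)%R <= K%:E)%E].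
Proof.
move=> p0 K0 mG G0 ndG GK.
pose F N x : \bar R := (`|G N x| `^ p)%:E.
have mF N : measurable_fun setT (F N) by exact: measurable_normpowR.
have F0 N x : (0 <= F N x)%E by rewrite lee_fin powR_ge0.
have ndF x : {homo F ^~ x : n m / (n <= m)%N >-> (n <= m)%E}.
  move=> n m nm; rewrite lee_fin ge0_ler_powR ?nnegrE//; first exact: ltW.
  by rewrite !ger0_norm// ndG.
pose F' x := limn (F ^~ x).
have cF x : cvgn (F ^~ x) by exact: ereal_nondecreasing_is_cvgn.
have FF' N x : (F N x <= F' x)%E.
  rewrite /F' (cvg_lim _ (ereal_nondecreasing_cvgn (ndF x)))//.
  by apply: ereal_sup_ubound; exists N.
have F'0 x : (0 <= F' x)%E by exact: le_trans (F0 0%N x) (FF' 0%N x).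
have mF' : measurable_fun setT F'.
  by apply: (emeasurable_fun_cvg F) => // x _; exact: cF.
have iF' : (\int[P]_x F' x <= (K `^ p)%:E)%E.
  have cI := @cvg_monotone_convergence _ _ _ P _ measurableT _ mF (fun n x _ => F0 n x) (fun x _ => ndF x).
  rewrite -(cvg_lim (@ereal_hausdorff R) cI); apply: lime_le.
    by apply/cvg_ex; eexists; exact: cI.
  by apply: nearW => N; apply/(Lnorm_leP (G N) p0 K0).
exists (fun x => fine (F' x) `^ p^-1); split.
- apply: (@measurableT_comp _ _ _ _ _ _ (@powR R ^~ p^-1)) => //.
  exact: measurableT_comp.
- by move=> x; rewrite powR_ge0.
- have : P.-integrable setT F'.
    apply/integrableP; split => //.
    under eq_integral do rewrite gee0_abs//.
    by apply: le_lt_trans iF' _; rewrite ltry.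
  move=> /(integrable_ae measurableT); apply: filterS => x /(_ I) Fx N.
  rewrite -[leLHS]powRr1// -(@mulfV _ p) ?gt_eqF// powRrM.
  apply: ge0_ler_powR; rewrite ?nnegrE ?powR_ge0 ?fine_ge0 ?invr_ge0 ?(ltW p0)//.
  by rewrite -lee_fin fineK//; have := FF' N x; rewrite /F ger0_norm.
- apply/Lnorm_leP => //; apply: le_trans iF'; apply: ge0_le_integral => //.
  + apply: measurable_normpowR.
    apply: (@measurableT_comp _ _ _ _ _ _ (@powR R ^~ p^-1)) => //.
    exact: measurableT_comp.
  + move=> x _; rewrite ger0_norm ?powR_ge0// -powRrM mulVf ?gt_eqF// powRr1 ?fine_ge0//.
    by have := F'0 x; case: (F' x).
Qed.

End moments.

Section probability_moments.
Context d (T : measurableType d) (R : realType).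
Variable P : probability T R.
Implicit Types f g : T -> R.

Local Notation norm p f := (Lnorm P p%:E (EFin \o f)).

(** Lyapunov's inequality up to a factor: with y = |f| / s, y^(2r) <= 1 + y^q,
    and 1 + 1 = 2 <= 2^r. *)
Lemma Lnorm_sqr_le f (r q s : R) : 1 <= r -> 2 * r <= q -> 0 < s ->
  measurable_fun setT f -> (norm q (f)%R <= s%:E)%E ->
  (norm r (fun x => f x ^+ 2)%R <= (2 * s ^+ 2)%:E)%E.
Proof.
move=> r1 rq s0 mf; have r0 : 0 < r by rewrite (lt_le_trans ltr01).
have q0 : 0 < q by rewrite (lt_le_trans _ rq)// mulr_gt0.
move=> /(Lnorm_leP _ _ q0 (ltW s0)) fs.
apply/Lnorm_leP; rewrite ?mulr_ge0 ?exprn_ge0 ?(ltW s0)//.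
pose c := s `^ (2 * r).
pose c' := (s `^ (q - 2 * r))^-1.
have c0 : 0 <= c by exact: powR_ge0.
have c'0 : 0 <= c' by rewrite invr_ge0 powR_ge0.
have pw x : `|f x ^+ 2| `^ r <= c + c' * `|f x| `^ q.
  rewrite normrX -powR_mulrn// -powRrM.
  have [fx|fx] := leP `|f x| s.
    apply: ler_wpDr; first by rewrite mulr_ge0 ?powR_ge0.
    by apply: ge0_ler_powR; rewrite ?nnegrE ?(ltW s0)// mulr_ge0// ltW.
  apply: ler_wpDl => //.
  have fx0 : 0 < `|f x| := lt_trans s0 fx.
  rewrite /c' ler_pdivlMl ?powR_gt0//.
  rewrite [leRHS](_ : _ = `|f x| `^ (q - 2 * r) * `|f x| `^ (2 * r)); last first.
    by rewrite -powRD ?subrK// gt_eqF// implybT.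
  rewrite ler_wpM2r ?powR_ge0// ge0_ler_powR ?nnegrE ?subr_ge0 ?(ltW s0) ?(ltW fx0)//.
  exact: ltW.
apply: (@le_trans _ _ (\int[P]_x (c%:E + (c' * `|f x| `^ q)%:E))%E).
  apply: ge0_le_integral => //.
  - by apply: measurable_normpowR; exact: measurable_funX.
  - apply: emeasurable_funD => //; under eq_fun do rewrite EFinM.
    by apply: measurable_funeM; exact: measurable_normpowR.
  - by move=> x _; rewrite -EFinD lee_fin.
rewrite ge0_integralD//; last 2 first.
- by move=> x _; rewrite lee_fin mulr_ge0 ?powR_ge0.
- under eq_fun do rewrite EFinM.
  by apply: measurable_funeM; exact: measurable_normpowR.
rewrite integral_cst// [X in (_ * X + _)%E](_ : _ = 1%E) ?mule1; last exact: probability_setT.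
under eq_integral do rewrite EFinM.
rewrite ge0_integralZl_EFin//; last exact: measurable_normpowR.
apply: (@le_trans _ _ (c%:E + c'%:E * (s `^ q)%:E)%E).
  by apply: leeD2l; apply: lee_wpmul2l; rewrite ?lee_fin.
rewrite -EFinM -EFinD lee_fin.
have -> : c' * s `^ q = c.
  rewrite (_ : s `^ q = s `^ (q - 2 * r) * s `^ (2 * r)); last first.
    by rewrite -powRD ?subrK// gt_eqF// implybT.
  by rewrite mulrA mulVf ?mul1r// gt_eqF// powR_gt0.
rewrite powRM ?exprn_ge0 ?(ltW s0)//.
rewrite -powR_mulrn ?(ltW s0)// -powRrM -/c -mulr2n -[c *+ 2]mulr_natl.
by rewrite ler_wpM2r// -[leLHS]powRr1// ler_powR// ler1n.
Qed.

(** Minkowski's inequality for the partial sums, then a common majorant. *)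
Lemma weighted_sqr_moment (Y : nat -> nat -> T -> R) (alpha : nat -> nat -> R)
    (r q s A : R) : 1 <= r -> 2 * r <= q -> 0 < s -> 0 <= A ->
  (forall i k, measurable_fun setT (Y i k)) ->
  (forall i k, (norm q (Y i k) <= s%:E)%E) ->
  (forall i k, 0 <= alpha i k) ->
  (forall N, \sum_(0 <= i < N) \sum_(0 <= k < N) alpha i k <= A) ->
  exists g, [/\ measurable_fun setT g, forall x, 0 <= g x,
    {ae P, forall x, forall N,
      \sum_(0 <= i < N) \sum_(0 <= k < N) alpha i k * Y i k x ^+ 2 <= g x} &
    (norm r g <= (A * (2 * s ^+ 2))%:E)%E].
Proof.
move=> r1 rq s0 A0 mY Ys alpha0 alphaA.
have r0 : 0 < r by rewrite (lt_le_trans ltr01).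
have s20 : 0 <= 2 * s ^+ 2 by rewrite mulr_ge0// sqr_ge0.
have mZ i k : measurable_fun setT (fun x => alpha i k * Y i k x ^+ 2).
  by apply: measurable_funM => //; exact: measurable_funX.
have mS i N : measurable_fun setT (fun x => \sum_(0 <= k < N) alpha i k * Y i k x ^+ 2).
  by apply: measurable_sum => k; exact: mZ.
apply: (sup_moment (G := fun N x =>
    \sum_(0 <= i < N) \sum_(0 <= k < N) alpha i k * Y i k x ^+ 2)) => //.
- by rewrite mulr_ge0.
- by move=> N; apply: measurable_sum => i; exact: mS.
- move=> N x; apply: sumr_ge0 => i _; apply: sumr_ge0 => k _.
  by rewrite mulr_ge0 ?sqr_ge0.
- move=> x n m nm; rewrite (double_sum_truncate (fun i k => alpha i k * Y i k x ^+ 2) nm).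
  apply: ler_sum => i _; apply: ler_sum => k _.
  by case: ifP => // _; rewrite mulr_ge0 ?sqr_ge0.
- move=> N; apply: (@le_trans _ _ (\sum_(0 <= i < N) \sum_(0 <= k < N)
    alpha i k * (2 * s ^+ 2))%:E); last first.
    rewrite lee_fin; under eq_bigr do rewrite -mulr_suml.
    by rewrite -mulr_suml ler_wpM2r.
  apply: Lnorm_sum_le => // i; apply: Lnorm_sum_le => // k.
  apply: LnormZ_le => //; first exact: measurable_funX.
  exact: Lnorm_sqr_le rq s0 (mY i k) (Ys i k).
Qed.

(** The p-th power of a maximum is at most the sum of the p-th powers. *)
Lemma max_moment J (Z : nat -> T -> R) (p K : R) : 0 < p -> 0 <= K ->
  (forall j, measurable_fun setT (Z j)) -> (forall j x, 0 <= Z j x) ->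
  (forall j, (j < J)%N -> (norm p (Z j) <= K%:E)%E) ->
  (norm p (fun x => \big[Num.max/0]_(j < J) Z j x)%R <= (J%:R `^ p^-1 * K)%:E)%E.
Proof.
move=> p0 K0 mZ Z0 ZK.
have max0 x (s : seq 'I_J) : 0 <= \big[Num.max/0]_(j <- s) Z j x.
  by elim/big_ind: _ => // y z y0 z0; rewrite le_max y0.
have mmax : measurable_fun setT (fun x => \big[Num.max/0]_(j < J) Z j x).
  elim: (index_enum _) => [|j s IH].
    by under eq_fun do rewrite big_nil; exact: measurable_cst.
  under eq_fun do rewrite big_cons.
  exact: measurable_maxr.
apply/Lnorm_leP => //; first by rewrite mulr_ge0 ?powR_ge0.
rewrite powRM ?powR_ge0// -powRrM mulVf ?gt_eqF// powRr1 ?ler0n//.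
apply: (@le_trans _ _ (\int[P]_x (\sum_(j < J) (`|Z j x| `^ p)%:E))%E).
  apply: ge0_le_integral => //.
  - exact: measurable_normpowR.
  - by apply: emeasurable_sum => j; exact: measurable_normpowR.
  - move=> x _; rewrite sumEFin lee_fin ger0_norm//.
    elim: (index_enum _) => [|j s IH].
      by rewrite !big_nil powR0// gt_eqF.
    rewrite !big_cons /Num.max; case: ifPn => _.
      by rewrite ler_wpDl ?powR_ge0.
    by rewrite ger0_norm// ler_wpDr// sumr_ge0// => k _; rewrite powR_ge0.
rewrite ge0_integral_sum//; last first.
  by move=> j; exact: measurable_normpowR.
apply: (@le_trans _ _ (\sum_(j < J) (K `^ p)%:E)%E).
  by apply: lee_sum => j _; apply/(Lnorm_leP _ _ p0 K0); exact: ZK.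
by rewrite sumEFin lee_fin sumr_const card_ord mulr_natl.
Qed.

End probability_moments.

(** * The random operator *)

Section setup.
Context d (X : measurableType d) (R : realType).
Variable mu : {measure set X -> \bar R}.
Variable S : eigen_setup mu.

Local Notation lam := (lambda S).
Local Notation lamt := (lambdat S).

Definition noise i k (w : Omega S) : R :=
  centered (Pr S) (etaD S i k) w - etaR S i k w.

Lemma lambda_le i j : (i <= j)%N -> lam j <= lam i.
Proof.
elim: j => [|j IH]; first by rewrite leqn0 => /eqP ->.
rewrite leq_eqVlt => /predU1P[->//|]; rewrite ltnS => /IH.
exact: le_trans (lambda_noninc S j).
Qed.

Lemma opD_entry i k : L2dot (opD S (eig S i)) (eig S k) = (i == k)%:R * lam i.
Proof.
have [oe _] := eig_basis S.
have := @L2cvg_dot _ _ _ _ _ _ (eig S k) (D_spectral S (eig S i)).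
move=> /(cvg_lim (@Rhausdorff R)) <-.
apply: cvg_lim => //; apply: cvg_near_cst; exists i.+1 => // N /= iN.
rewrite L2dot_suml -(big_mkord xpredT (fun j => L2dot ((lam j * L2dot (eig S j) (eig S i)) *: eig S j) (eig S k))).
rewrite -(sum_nat_delta (fun j => (j == k)%:R * lam j) iN).
by apply: eq_bigr => j _; rewrite L2dotZl !oe; ring.
Qed.

(** Both expansions represent D, and coefficients in an orthonormal basis are
    unique. *)
Lemma mean_entry i k :
  Num.sqrt (lamt i * lamt k) * fine 'E_(Pr S)[etaD S i k] = (i == k)%:R * lam i.
Proof.
by rewrite -opD_entry (matrix_operator_entry (eig_basis S) (D_expansion S)).
Qed.

Lemma lambdat_le C j : 0 < C -> ((C^-1)%:E <= 'E_(Pr S)[etaD S j j] <= C%:E)%E ->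
  lamt j <= C * lam j.
Proof.
move=> C0 /andP[C1 C2].
have := mean_entry j j; rewrite eqxx mul1r -expr2 sqrtr_sqr ger0_norm ?lambdat_ge0// => <-.
have Ef : ('E_(Pr S)[etaD S j j] \is a fin_num)%E.
  by rewrite fin_numElt (lt_le_trans _ C1) ?ltNyr// (le_lt_trans C2) ?ltry.
move: C1; rewrite -(fineK Ef) lee_fin => C1.
rewrite mulrCA; apply: ler_peMr; first exact: lambdat_ge0.
by rewrite mulrC -ler_pdivrMr// mul1r.
Qed.

Lemma noise_entry i k w :
  Num.sqrt (lamt i * lamt k) * (etaD S i k w - etaR S i k w) =
  (i == k)%:R * lam i + Num.sqrt (lamt i * lamt k) * noise i k w.
Proof. by rewrite -mean_entry /noise /centered; ring. Qed.

Lemma sqr_noise_entry i k w :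
  (Num.sqrt (lamt i * lamt k) * noise i k w) ^+ 2 = lamt i * lamt k * noise i k w ^+ 2.
Proof. by rewrite exprMn sqr_sqrtr// mulr_ge0// lambdat_ge0. Qed.

Lemma measurable_noise i k : measurable_fun setT (noise i k).
Proof.
apply: measurable_funB; last exact: measurable_funPT.
by apply: measurable_funB => //; exact: measurable_funPT.
Qed.

Lemma noise_Lnorm (q K L : R) i k : 1 <= q -> 0 <= L ->
  ('N[Pr S]_q%:E[EFin \o centered (Pr S) (etaD S i k)] <= K%:E)%E ->
  ('N[Pr S]_q%:E[EFin \o etaR S i k] <= L%:E)%E ->
  ('N[Pr S]_q%:E[EFin \o noise i k] <= (K + L)%:E)%E.
Proof.
move=> q1 L0 HK HL.
have mR : measurable_fun setT (etaR S i k) by exact: measurable_funPT.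
have mN : measurable_fun setT (fun w => - etaR S i k w) by exact: measurableT_comp.
apply: LnormD_le => //.
  by apply: measurable_funB => //; exact: measurable_funPT.
apply: (Lnorm_ae_le _ L0 mN mR _ HL); first exact: lt_le_trans q1.
by apply: nearW => w; rewrite normrN.
Qed.

Lemma measurable_Idev i k : measurable_fun setT (Idev S i k).
Proof.
rewrite (_ : Idev S i k = fun w => L2dot (opDhat w (eig S i)) (eig S k) -
    L2dot (opD S (eig S i)) (eig S k)); last first.
  by apply/funext => w; rewrite /Idev L2dotBl.
by apply: measurable_funB => //; exact: Dhat_measurable.
Qed.

Definition relative_error j (w : Omega S) : R :=
  `|(lam j)^-1 * (lambdahat S j w - lam j - Idev S j j w)|.

Lemma measurable_relative_error j : measurable_fun setT (relative_error j).
Proof.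
apply: measurableT_comp => //; apply: measurable_funM => //.
apply: measurable_funB; last exact: measurable_Idev.
by apply: measurable_funB => //; exact: measurable_funPT.
Qed.

(** The weights of the relative bound; w_j is an explicit lower bound for the
    spectral gap at j instead of the gap itself. *)
Definition gap_weight (j : nat) (B : R) i : R :=
  if i == j then lam j / (2 * B) else `|lam j - lam i|.

Section gap.
Variables (j : nat) (B : R).
Hypothesis lamj : 0 < lam j.
Hypothesis B1 : 1 <= B.
Hypothesis lam_neq : forall i, i != j -> lam i != lam j.
Hypothesis lamB : forall N,
  \sum_(0 <= i < N | i != j) lam i / `|lam j - lam i| <= B.

Let B0 : 0 < B. Proof. exact: lt_le_trans B1. Qed.

Let gap0 i : i != j -> 0 < `|lam j - lam i|.
Proof. by move=> ij; rewrite normr_gt0 subr_eq0 eq_sym lam_neq. Qed.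

Lemma gap_weight_gt0 i : 0 < gap_weight j B i.
Proof.
rewrite /gap_weight; case: eqVneq => [_|ij]; last exact: gap0.
by rewrite divr_gt0// mulr_gt0.
Qed.

Lemma gap_weightE i : i != j -> gap_weight j B i = `|lam j - lam i|.
Proof. by rewrite /gap_weight => /negbTE ->. Qed.

Lemma gap_weight_le_lambda : gap_weight j B j <= lam j.
Proof.
rewrite /gap_weight eqxx ler_pdivrMr ?mulr_gt0//.
by apply: ler_peMr; [exact: ltW|have := B1; lra].
Qed.

(** With g = |lambda_j - lambda_i|: either lambda_j <= lambda_i <= B g, or
    lambda_j = g + lambda_i <= (1 + B) g <= 2 B g. *)
Lemma gap_weight_min i : gap_weight j B j <= gap_weight j B i.
Proof.
have [->//|ij] := eqVneq i j.
rewrite [gap_weight j B i]gap_weightE// [leLHS](_ : _ = lam j / (2 * B)); last by rewrite /gap_weight eqxx.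
rewrite ler_pdivrMr ?mulr_gt0//.
have gi := gap0 ij.
have li : lam i <= B * `|lam j - lam i|.
  rewrite -ler_pdivrMr//; apply: le_trans (lamB i.+1).
  rewrite big_mkcond big_nat_recr//= ij ler_wpDl// sumr_ge0// => k _.
  by case: ifP => // _; rewrite divr_ge0 ?lambda_ge0.
have H : lam j - lam i <= `|lam j - lam i| := ler_norm _.
have : 1 * `|lam j - lam i| <= B * `|lam j - lam i| by rewrite ler_wpM2r.
lra.
Qed.

Lemma gap_weight_sum N : \sum_(0 <= i < N) lam i / gap_weight j B i <= 3 * B.
Proof.
have w0 i : 0 <= lam i / gap_weight j B i.
  by rewrite divr_ge0 ?lambda_ge0// ltW// gap_weight_gt0.
apply: (@le_trans _ _ (\sum_(0 <= i < N + j.+1) lam i / gap_weight j B i)).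
  rewrite [leRHS](@big_cat_nat _ _ _ N)//= ?leq_addr// lerDl.
  by apply: sumr_ge0 => i _.
rewrite (bigD1_seq j) ?mem_index_iota ?iota_uniq//=; last by rewrite addnS ltnS leq_addl.
have -> : lam j / gap_weight j B j = 2 * B.
  by rewrite /gap_weight eqxx; field; rewrite !gt_eqF.
have := lamB (N + j.+1).
under [X in _ -> _ + X <= _]eq_bigr => i ij do rewrite gap_weightE//.
lra.
Qed.

End gap.

End setup.

Section one_eigenvalue.
Context d (X : measurableType d) (R : realType).
Variable mu : {measure set X -> \bar R}.
Variable S : eigen_setup mu.

Local Notation lam := (lambda S).
Local Notation lamt := (lambdat S).

Variables (j : nat) (B : R).
Hypothesis lamj : 0 < lam j.
Hypothesis B1 : 1 <= B.
Hypothesis lam_neq : forall i, i != j -> lam i != lam j.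
Hypothesis lamB : forall N,
  \sum_(0 <= i < N | i != j) lam i / `|lam j - lam i| <= B.

Local Notation w := (gap_weight S j B).

Let w0 i : 0 < w i. Proof. exact: gap_weight_gt0. Qed.

(** With the next two weights, [weighted_noise] below is the N-th partial sum of
    V, of X and of the squared Hilbert-Schmidt norm of the perturbation. *)
Definition row_weight i k : R := (k == j)%:R * ((i != j)%:R * (lamt i * lamt j / w i)).

Definition relative_weight i k : R := lamt i * lamt k / (w i * w k).

Definition hs_weight i k : R := lamt i * lamt k.

Definition weighted_noise (alpha : nat -> nat -> R) N (x : Omega S) :=
  \sum_(0 <= i < N) \sum_(0 <= k < N) alpha i k * noise i k x ^+ 2.

(** Off the good event gX <= 1/16 the crude bound is paid for by the factor
    (16 gX)^n >= 1, whose moments are small; sqrt gH is linearized by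
    2 sqrt gH <= eps^-1 + eps gH. *)
Lemma relative_error_le n eps (x : Omega S) gV gX gH (C : R) : 0 < eps ->
  (forall N, \sum_(0 <= i < N) lam i <= C) ->
  matrix_operator (eig S) (fun i k => Num.sqrt (lamt i * lamt k) *
    (etaD S i k x - etaR S i k x)) (opDhat x) ->
  self_adjoint (opDhat x) ->
  ordered_eigensystem (opDhat x) (lambdahat S ^~ x) (fun i => ehat i x) ->
  (forall N, weighted_noise row_weight N x <= gV) ->
  (forall N, weighted_noise relative_weight N x <= gX) ->
  (forall N, weighted_noise hs_weight N x <= gH) ->
  relative_error j x <= 2 / lam j * gV + (1 + (lam j * eps)^-1) * (16 * gX) ^+ n +
    eps / lam j * gH.
Proof.
move=> eps0 lamC Dm Ds De HV HX HH.
set a := (fun i k : nat => _) in Dm.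
pose E i k := a i k - (i == k)%:R * lam i.
have EE i k : E i k = Num.sqrt (lamt i * lamt k) * noise i k x.
  by rewrite /E /a noise_entry addrC addKr.
have E2 i k : E i k ^+ 2 = lamt i * lamt k * noise i k x ^+ 2.
  by rewrite EE sqr_noise_entry.
have gV0 : 0 <= gV by have := HV 0%N; rewrite /weighted_noise big_geq.
have gX0 : 0 <= gX by have := HX 0%N; rewrite /weighted_noise big_geq.
have gH0 : 0 <= gH by have := HH 0%N; rewrite /weighted_noise big_geq.
have EH N : hs_sqr E N <= gH.
  apply: le_trans (HH N); rewrite le_eqVlt; apply/orP; left; apply/eqP.
  by apply: eq_bigr => i _; apply: eq_bigr => k _; rewrite E2.
have IE : Idev S j j x = E j j.
  by rewrite /Idev L2dotBl opD_entry (matrix_operator_entry (eig_basis S) Dm).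
have lamnoninc i k : (i <= k)%N -> lam k <= lam i := @lambda_le _ _ _ _ S i k.
have lamjV : 0 < (lam j)^-1 by rewrite invr_gt0.
have T0 : 0 <= 2 / lam j * gV by rewrite mulr_ge0// mulr_ge0// ltW.
have T2 : 0 <= eps / lam j * gH by rewrite mulr_ge0// mulr_ge0// ltW.
have leV : 0 <= (lam j * eps)^-1 by rewrite invr_ge0 mulr_ge0// ltW.
rewrite /relative_error normrM (gtr0_norm lamjV) IE.
have [gX16|gX16] := leP gX (4^-1 ^+ 2).
- apply: (@le_trans _ _ (2 / lam j * gV)); last first.
    rewrite -addrA lerDl addr_ge0// mulr_ge0 ?addr_ge0// exprn_ge0// mulr_ge0//.
  rewrite mulrAC mulrC ler_pM2r//.
  apply: (@eigenvalue_relative_bound _ _ _ _ _ (eig_basis S) _ _ Dm Ds _ _ De lam lamnoninc j w).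
  + rewrite (_ : a = fun i k => E i k - - ((i == k)%:R * lam i)); last first.
      by apply/funext => i; apply/funext => k; rewrite /E opprK subrK.
    apply: hs_sqrB_bounded; first by exists gH.
    exists (lam 0%N * C) => N; rewrite /hs_sqr.
    apply: (@le_trans _ _ (\sum_(0 <= i < N) lam 0%N * lam i)); last first.
      by rewrite -mulr_sumr ler_wpM2l ?lambda_ge0.
    rewrite big_nat [leRHS]big_nat; apply: ler_sum => i /= iN.
    rewrite (eq_bigr (fun k => (k == i)%:R * lam i ^+ 2)).
      by rewrite sum_nat_delta// expr2 ler_wpM2r ?lambda_ge0// lamnoninc.
    by move=> k _; rewrite sqrrN exprMn eq_sym; case: eqP => _; rewrite /= ?expr1n ?expr0n.
  + exact: w0.
  + by move=> i ij; rewrite gap_weightE.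
  + by move=> i; exact: gap_weight_min.
  + exact: gap_weight_le_lambda.
  + move=> N; apply: le_trans (le_trans (HX N) gX16).
    rewrite le_eqVlt; apply/orP; left; apply/eqP.
    apply: eq_bigr => i _; apply: eq_bigr => k _.
    by rewrite -/(E i k) E2 /relative_weight mulrAC.
  + move=> N; apply: le_trans (HV (N + j.+1)%N).
    apply: (@le_trans _ _ (\sum_(0 <= i < N + j.+1 | i != j) E i j ^+ 2 / w i)).
      rewrite [leRHS](@big_cat_nat _ _ _ N)//= ?leq_addr// lerDl.
      by apply: sumr_ge0 => i _; rewrite divr_ge0 ?sqr_ge0// ltW.
    rewrite big_mkcond; apply: ler_sum => i _.
    rewrite (eq_bigr (fun k => (k == j)%:R *
        ((i != j)%:R * (lamt i * lamt j / w i) * noise i k x ^+ 2))); last first.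
      by move=> k _; rewrite /row_weight !mulrA.
    rewrite sum_nat_delta; last by rewrite addnS ltnS leq_addl.
    case: ifP => _ /=; last by rewrite !mul0r.
    by rewrite mul1r E2 mulrAC.
- have big1n : 1 <= (16 * gX) ^+ n.
    apply: exprn_ege1; move: gX16; rewrite expr2; lra.
  pose h := Num.sqrt gH.
  have h2 : h ^+ 2 = gH by rewrite sqr_sqrtr.
  have := @eigenvalue_crude_bound _ _ _ _ _ (eig_basis S) _ _ Dm Ds _ _ De lam lamnoninc j h
    (lambda_ge0 S) (sqrtr_ge0 _).
  rewrite h2 => /(_ EH) crude.
  apply: (le_trans (ler_wpM2l (ltW lamjV) crude)).
  have hle : 2 * h <= eps^-1 + eps * gH.
    rewrite -h2 -subr_ge0 (_ : _ - _ = eps^-1 * (1 - eps * h) ^+ 2).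
      by rewrite mulr_ge0 ?sqr_ge0// invr_ge0 ltW.
    by field; rewrite gt_eqF.
  have H1 : (lam j)^-1 * (lam j + 2 * h) <= 1 + (lam j * eps)^-1 + eps / lam j * gH.
    apply: (@le_trans _ _ ((lam j)^-1 * (lam j + (eps^-1 + eps * gH)))).
      by rewrite ler_pM2l// lerD2l.
    rewrite le_eqVlt; apply/orP; left; apply/eqP; field.
    by rewrite !gt_eqF.
  apply: le_trans H1 _; rewrite lerD2r -[leLHS]add0r lerD//.
  by rewrite ler_peMr// addr_ge0.
Qed.

Lemma relative_error_moment n eps (p q sg C : R) : (0 < n)%N -> 0 < eps -> 1 <= p ->
  2 * (n%:R * p) <= q -> 0 < sg -> 0 < C ->
  (forall N, \sum_(0 <= i < N) lam i <= C) ->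
  (forall i, lamt i <= C * lam i) ->
  (forall i k, ('N[Pr S]_q%:E[EFin \o noise i k] <= sg%:E)%E) ->
  ('N[Pr S]_p%:E[EFin \o relative_error j] <=
    (2 / lam j * (C ^+ 2 * lam j * B * (2 * sg ^+ 2)) +
     (1 + (lam j * eps)^-1) * (16 * ((3 * C * B) ^+ 2 * (2 * sg ^+ 2))) ^+ n +
     eps / lam j * (C ^+ 4 * (2 * sg ^+ 2)))%:E)%E.
Proof.
move=> n0 eps0 p1 npq sg0 C0 lamC lamtC noiseq.
have p0 : 0 < p := lt_le_trans ltr01 p1.
have B0 : 0 < B := lt_le_trans ltr01 B1.
have np1 : 1 <= n%:R * p by rewrite mulr_ege1// ler1n.
have pq : 2 * p <= q.
  by apply: le_trans npq; rewrite ler_pM2l// ler_peMl ?(ltW p0)// ler1n.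
have lt0 i : 0 <= lamt i := lambdat_ge0 S i.
have mY i k := @measurable_noise _ _ _ _ S i k.
have wl0 i : 0 <= lam i / w i by rewrite divr_ge0 ?lambda_ge0// ltW.
have Cl0 i : 0 <= C * lam i by rewrite mulr_ge0 ?lambda_ge0// ltW.
have ltw i : lamt i / w i <= C * (lam i / w i).
  by rewrite mulrA ler_wpM2r ?invr_ge0 ?(ltW (w0 i)).
have [gV [mV V0 VP NV]] : exists g : Omega S -> R, [/\ measurable_fun setT g, forall x, 0 <= g x,
    {ae Pr S, forall x, forall N, weighted_noise row_weight N x <= g x} &
    ('N[Pr S]_p%:E[EFin \o g] <= (C ^+ 2 * lam j * B * (2 * sg ^+ 2))%:E)%E].
  apply: (weighted_sqr_moment p1 pq sg0) => //.
  - by rewrite !mulr_ge0 ?exprn_ge0 ?(ltW C0) ?(ltW lamj) ?(ltW B0).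
  - by move=> i k; rewrite /row_weight !mulr_ge0// invr_ge0 ltW.
  - move=> N; apply: (@le_trans _ _ (\sum_(0 <= i < N | i != j) C ^+ 2 * lam j * (lam i / `|lam j - lam i|))); last first.
      rewrite -mulr_sumr ler_wpM2l// mulr_ge0 ?exprn_ge0 ?(ltW C0) ?(ltW lamj)//.
    rewrite [leRHS]big_mkcond/=; apply: ler_sum => i _.
    have c0 : 0 <= (i != j)%:R * (lamt i * lamt j / w i).
      by rewrite !mulr_ge0// invr_ge0 ltW.
    apply: (@le_trans _ _ ((i != j)%:R * (lamt i * lamt j / w i))).
      rewrite /row_weight; have [jN|Nj] := ltnP j N.
        by rewrite (sum_nat_delta (fun=> (i != j)%:R * (lamt i * lamt j / w i)) jN).
      rewrite big_nat big1// => k /= kN.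
      by rewrite ltn_eqF ?mul0r// (leq_trans kN).
    case: ifPn => ij /=; last by rewrite mul0r.
    rewrite mul1r -(gap_weightE S B ij).
    rewrite (_ : _ / w i = lamt i / w i * lamt j); last by rewrite mulrAC.
    apply: (@le_trans _ _ ((C * (lam i / w i)) * (C * lam j))).
      by apply: ler_pM => //; rewrite divr_ge0// ltW.
    by rewrite le_eqVlt; apply/orP; left; apply/eqP; ring.
have [gX [mX X0 XP NX]] : exists g : Omega S -> R, [/\ measurable_fun setT g, forall x, 0 <= g x,
    {ae Pr S, forall x, forall N, weighted_noise relative_weight N x <= g x} &
    ('N[Pr S]_(n%:R * p)%:E[EFin \o g] <= ((3 * C * B) ^+ 2 * (2 * sg ^+ 2))%:E)%E].
  apply: (weighted_sqr_moment np1 npq sg0) => //.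
  - by rewrite exprn_ge0// !mulr_ge0 ?(ltW C0) ?(ltW B0).
  - by move=> i k; rewrite /relative_weight !mulr_ge0// invr_ge0 mulr_ge0// ltW.
  - move=> N; rewrite (_ : \sum_(0 <= i < N) _ = (\sum_(0 <= i < N) lamt i / w i) ^+ 2).
      rewrite ler_sqr ?nnegrE; last 2 first.
        by apply: sumr_ge0 => i _; rewrite divr_ge0// ltW.
        by rewrite !mulr_ge0 ?(ltW C0) ?(ltW B0).
      apply: (@le_trans _ _ (\sum_(0 <= i < N) C * (lam i / w i))).
        exact: ler_sum.
      rewrite -mulr_sumr -mulrA mulrCA ler_pM2l//.
      exact: gap_weight_sum.
    rewrite expr2 mulr_suml; apply: eq_bigr => i _.
    rewrite mulr_sumr; apply: eq_bigr => k _.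
    by rewrite /relative_weight invfM mulrACA.
have [gH [mH H0 HP NH]] : exists g : Omega S -> R, [/\ measurable_fun setT g, forall x, 0 <= g x,
    {ae Pr S, forall x, forall N, weighted_noise hs_weight N x <= g x} &
    ('N[Pr S]_p%:E[EFin \o g] <= (C ^+ 4 * (2 * sg ^+ 2))%:E)%E].
  apply: (weighted_sqr_moment p1 pq sg0) => //.
  - by rewrite exprn_ge0// ltW.
  - by move=> i k; rewrite mulr_ge0.
  - move=> N; rewrite (_ : \sum_(0 <= i < N) _ = (\sum_(0 <= i < N) lamt i) ^+ 2).
      rewrite (_ : C ^+ 4 = (C * C) ^+ 2); last by ring.
      rewrite ler_sqr ?nnegrE ?sumr_ge0 ?mulr_ge0 ?(ltW C0)//.
      apply: (@le_trans _ _ (\sum_(0 <= i < N) C * lam i)); first exact: ler_sum.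
      by rewrite -mulr_sumr ler_pM2l.
    rewrite expr2 mulr_suml; apply: eq_bigr => i _.
    by rewrite mulr_sumr.
have lamV0 : 0 <= (lam j)^-1 by rewrite invr_ge0 ltW.
have leV : 0 <= (lam j * eps)^-1 by rewrite invr_ge0 mulr_ge0// ltW.
have sg2 : 0 <= 2 * sg ^+ 2 by rewrite mulr_ge0// sqr_ge0.
have KV : 0 <= C ^+ 2 * lam j * B * (2 * sg ^+ 2).
  by rewrite !mulr_ge0 ?exprn_ge0 ?(ltW C0) ?(ltW lamj) ?(ltW B0) ?(ltW sg0).
have KX : 0 <= (3 * C * B) ^+ 2 * (2 * sg ^+ 2).
  by rewrite mulr_ge0// exprn_ge0// !mulr_ge0 ?(ltW C0) ?(ltW B0).
have KH : 0 <= C ^+ 4 * (2 * sg ^+ 2) by rewrite mulr_ge0// exprn_ge0// ltW.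
have c1 : 0 <= 2 / lam j by rewrite mulr_ge0.
have c2 : 0 <= 1 + (lam j * eps)^-1 by rewrite addr_ge0.
have c3 : 0 <= eps / lam j by rewrite mulr_ge0// ltW.
pose bound x := 2 / lam j * gV x + (1 + (lam j * eps)^-1) * (16 * gX x) ^+ n +
    eps / lam j * gH x.
have m16 : measurable_fun setT (fun x => 16 * gX x) by exact: measurable_funM.
have mX' : measurable_fun setT (fun x => (16 * gX x) ^+ n) by exact: measurable_funX.
have mb1 : measurable_fun setT (fun x => 2 / lam j * gV x) by exact: measurable_funM.
have mb2 : measurable_fun setT (fun x => (1 + (lam j * eps)^-1) * (16 * gX x) ^+ n).
  exact: measurable_funM.
have mb3 : measurable_fun setT (fun x => eps / lam j * gH x) by exact: measurable_funM.
have mb12 : measurable_fun setT (fun x => 2 / lam j * gV x +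
  (1 + (lam j * eps)^-1) * (16 * gX x) ^+ n) by exact: measurable_funD.
have mb : measurable_fun setT bound by exact: measurable_funD.
apply: (@Lnorm_ae_le _ _ _ (Pr S) (relative_error j) bound) => //.
- by rewrite !addr_ge0// mulr_ge0// exprn_ge0// mulr_ge0.
- exact: measurable_relative_error.
- have Dm := Dhat_expansion S; have Ds := Dhat_self_adjoint S.
  have De := Dhat_eigensystem S.
  apply: filter_app HP; apply: filter_app XP; apply: filter_app VP.
  apply: filter_app De; apply: filter_app Ds.
  move: Dm; apply: filterS => x Dm Ds De VP XP HP.
  rewrite {1}/relative_error normr_id; apply: le_trans (ler_norm _).
  exact: relative_error_le lamC Dm Ds De VP XP HP.
- apply: LnormD_le => //; last exact: LnormZ_le.
  apply: LnormD_le => //; first exact: LnormZ_le.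
  apply: LnormZ_le => //; first by rewrite exprn_ge0// mulr_ge0.
  apply: LnormX_le => //; first by rewrite mulr_ge0.
  apply: LnormZ_le => //.
  exact: lt_le_trans np1.
Qed.

End one_eigenvalue.

(** * Rates *)

Section rates.
Context (R : realType).

(** Turns the asymptotic hypotheses on m and s into bounds for every index. *)
Lemma eventually_bounded (u : nat -> R) (b : R) :
  (\forall k \near \oo, u k <= b) -> exists2 c, 0 < c & forall k, u k <= c.
Proof.
move=> [K _ Kb].
have [c cP] : exists c, forall k, (k < K)%N -> u k <= c.
  elim: K {Kb} => [|K [c cK]]; first by exists 0.
  exists (Num.max c (u K)) => k; rewrite ltnS leq_eqVlt => /predU1P[->|kK].
    by rewrite le_max lexx orbT.
  by rewrite le_max cK.
exists (Num.max 1 (Num.max b c)) => [|k]; first by rewrite lt_max ltr01.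
rewrite !le_max; have [kK|Kk] := ltnP k K; first by rewrite cP// !orbT.
by rewrite (Kb k Kk)/= orbT.
Qed.

(** Surplus negative powers of m are absorbed into a constant, as m is bounded
    away from 0. *)
Lemma powR_le_of_lb (dl m u : R) : 0 < dl -> dl <= m -> 0 <= u ->
  m `^ (- u) <= dl `^ (- u).
Proof.
move=> dl0 dlm u0; have m0 := lt_le_trans dl0 dlm.
rewrite !powRN lef_pV2 ?posrE ?powR_gt0//.
by rewrite ge0_ler_powR ?nnegrE// ltW.
Qed.

Definition rate_constant (C D a h dl : R) (n : nat) : R :=
  4 * C ^+ 3 * D ^+ 2 +
  (dl `^ (- (2 * a * n%:R - 2^-1 - a)) + C * dl `^ (- (2 * a * n%:R - 2 * h - 2 * a))) *
    (288 * C ^+ 4 * D ^+ 2) ^+ n +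
  2 * C ^+ 5 * D ^+ 2.

Lemma rate_constant_ge0 (C D a h dl : R) n : 0 <= C -> 0 <= D ->
  0 <= rate_constant C D a h dl n.
Proof.
by move=> C0 D0; rewrite /rate_constant !(addr_ge0, mulr_ge0, exprn_ge0, powR_ge0).
Qed.

(** The exponents: eps = m^(1/2 - a - h) balances the two terms that carry the
    bad event, and n a >= h + a makes the middle one negligible. *)
Lemma rate_le (m dl C D a h l : R) n : 0 < dl -> dl <= m -> 0 < C -> 0 < D ->
  1 <= h -> 0 < a -> h + a <= a * n%:R -> m `^ (- h) / C <= l ->
  let B := C * m `^ (2^-1 - a) in
  let sg := D * m `^ (- 2^-1) in
  let eps := m `^ (2^-1 - a - h) in
  2 / l * (C ^+ 2 * l * B * (2 * sg ^+ 2)) +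
    (1 + (l * eps)^-1) * (16 * ((3 * C * B) ^+ 2 * (2 * sg ^+ 2))) ^+ n +
    eps / l * (C ^+ 4 * (2 * sg ^+ 2)) <=
  rate_constant C D a h dl n * m `^ (- 2^-1 - a).
Proof.
move=> dl0 dlm C0 D0 h1 a0 na lC; cbv zeta.
set B := C * m `^ (2^-1 - a); set sg := D * m `^ (- 2^-1).
set eps := m `^ (2^-1 - a - h).
have m0 := lt_le_trans dl0 dlm.
have pD r s : m `^ r * m `^ s = m `^ (r + s).
  by rewrite -powRD// (gt_eqF m0) implybT.
have l0 : 0 < l by apply: lt_le_trans lC; rewrite divr_gt0// powR_gt0.
have lV : l^-1 <= C * m `^ h.
  have -> : C * m `^ h = (m `^ (- h) / C)^-1 by rewrite invf_div powRN invrK.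
  by rewrite lef_pV2 ?posrE// divr_gt0// powR_gt0.
have sg2 : sg ^+ 2 = D ^+ 2 * m `^ (- 1).
  rewrite /sg exprMn (expr2 (m `^ _)) pD; congr (_ * m `^ _); by field.
have E1 : 2 / l * (C ^+ 2 * l * B * (2 * sg ^+ 2)) =
    4 * C ^+ 3 * D ^+ 2 * m `^ (- 2^-1 - a).
  have -> : m `^ (- 2^-1 - a) = m `^ (2^-1 - a) * m `^ (- 1).
    rewrite pD; congr (m `^ _); by field.
  by rewrite sg2 /B; field; rewrite gt_eqF.
have E2 : 16 * ((3 * C * B) ^+ 2 * (2 * sg ^+ 2)) =
    288 * C ^+ 4 * D ^+ 2 * m `^ (- (2 * a)).
  have -> : m `^ (- (2 * a)) = m `^ (2^-1 - a) * m `^ (2^-1 - a) * m `^ (- 1).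
    rewrite !pD; congr (m `^ _); by field.
  by rewrite sg2 /B; ring.
have E2n : (16 * ((3 * C * B) ^+ 2 * (2 * sg ^+ 2))) ^+ n =
    (288 * C ^+ 4 * D ^+ 2) ^+ n * m `^ (- (2 * a * n%:R)).
  rewrite E2 exprMn; congr (_ * _).
  by rewrite -powR_mulrn ?powR_ge0// -powRrM mulNr.
have lepsV : (l * eps)^-1 <= C * m `^ (2 * h + a - 2^-1).
  rewrite invfM; apply: (@le_trans _ _ (C * m `^ h * eps^-1)).
    by rewrite ler_wpM2r// invr_ge0 powR_ge0.
  rewrite /eps -powRN -mulrA pD le_eqVlt; apply/orP; left; apply/eqP.
  by congr (_ * m `^ _); ring.
have H2 : (1 + (l * eps)^-1) * (16 * ((3 * C * B) ^+ 2 * (2 * sg ^+ 2))) ^+ n <=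
    (dl `^ (- (2 * a * n%:R - 2^-1 - a)) + C * dl `^ (- (2 * a * n%:R - 2 * h - 2 * a))) *
    (288 * C ^+ 4 * D ^+ 2) ^+ n * m `^ (- 2^-1 - a).
  rewrite E2n.
  have c0 : 0 <= (288 * C ^+ 4 * D ^+ 2) ^+ n.
    by rewrite !(exprn_ge0, mulr_ge0)// ltW.
  apply: (@le_trans _ _ ((1 + C * m `^ (2 * h + a - 2^-1)) *
      ((288 * C ^+ 4 * D ^+ 2) ^+ n * m `^ (- (2 * a * n%:R))))).
    by rewrite ler_wpM2r ?mulr_ge0 ?powR_ge0// lerD2l.
  rewrite [leLHS](_ : _ = (m `^ (- (2 * a * n%:R)) +
      C * (m `^ (2 * h + a - 2^-1) * m `^ (- (2 * a * n%:R)))) *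
      (288 * C ^+ 4 * D ^+ 2) ^+ n); last by ring.
  rewrite [leRHS]mulrAC; apply: ler_wpM2r => //.
  rewrite pD.
  have -> : - (2 * a * n%:R) = - (2 * a * n%:R - 2^-1 - a) + (- 2^-1 - a) by ring.
  have -> : 2 * h + a - 2^-1 + (- (2 * a * n%:R - 2^-1 - a) + (- 2^-1 - a)) =
    - (2 * a * n%:R - 2 * h - 2 * a) + (- 2^-1 - a) by field.
  rewrite -(pD _ (- 2^-1 - a)) -(pD (- (2 * a * n%:R - 2 * h - 2 * a))) [leRHS]mulrDl mulrA.
  apply: lerD; first by rewrite ler_wpM2r ?powR_ge0// powR_le_of_lb//; lra.
  rewrite ler_wpM2r ?powR_ge0// ler_wpM2l ?(ltW C0)// powR_le_of_lb//; lra.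
have H3 : eps / l * (C ^+ 4 * (2 * sg ^+ 2)) <= 2 * C ^+ 5 * D ^+ 2 * m `^ (- 2^-1 - a).
  have -> : m `^ (- 2^-1 - a) = m `^ (2^-1 - a - h) * m `^ h * m `^ (- 1).
    rewrite !pD; congr (m `^ _); by field.
  rewrite sg2 -/eps.
  apply: (@le_trans _ _ (eps * (C * m `^ h) * (C ^+ 4 * (2 * (D ^+ 2 * m `^ (- 1)))))).
    apply: ler_wpM2r; first by rewrite !(mulr_ge0, exprn_ge0, powR_ge0)// ltW.
    by rewrite ler_wpM2l// powR_ge0.
  by rewrite le_eqVlt; apply/orP; left; apply/eqP; ring.
rewrite E1 /rate_constant [leRHS]mulrDl [X in _ <= X + _]mulrDl.
by apply: lerD => //; exact: lerD.
Qed.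

(** With c the ceiling of h / a: 2^(c+3) >= c + 1 >= h / a + 1. *)
Lemma exponent_large (h a : R) : 0 < a -> 1 <= h ->
  h + a <= a * (2 ^ (`|Num.ceil (h / a)| + 3))%:R.
Proof.
move=> a0 h1; set c := `|Num.ceil (h / a)|%N.
have hc : h / a <= c%:R.
  rewrite /c natr_absz ger0_norm; first exact: ceil_ge.
  by rewrite -(ler_int R) (le_trans _ (ceil_ge _))// divr_ge0// ?(ltW a0)//; lra.
have cn : c%:R + 1 <= (2 ^ (c + 3))%:R :> R.
  rewrite natr1 ler_nat (leq_trans (ltn_expl c (isT : (1 < 2)%N)))//.
  by rewrite leq_exp2l// leq_addr.
rewrite -ler_pdivrMl//.
apply: le_trans cn; rewrite mulrDr mulVf ?gt_eqF// lerD2r.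
by rewrite mulrC.
Qed.

(** If lambda_i = lambda_j, the i-th term of the extended real series is
    lambda_i / 0, which is infinite. *)
Lemma gap_series_bounds (lam : nat -> R) j (B : R) : (forall i, 0 <= lam i) -> 0 < lam j ->
  (\sum_(0 <= i <oo | i != j) ((lam i)%:E / `|lam j - lam i|%:E) <= B%:E)%E ->
  (forall i, i != j -> lam i != lam j) /\
  (forall N, \sum_(0 <= i < N | i != j) lam i / `|lam j - lam i| <= B).
Proof.
move=> lam0 lamj HB.
have t0 i : (0 <= (lam i)%:E / `|lam j - lam i|%:E)%E.
  by rewrite mule_ge0 ?inve_ge0 ?lee_fin.
have part N : (\sum_(0 <= i < N | i != j) ((lam i)%:E / `|lam j - lam i|%:E) <= B%:E)%E.
  by apply: le_trans HB; apply: nneseries_lim_ge => i _ _; exact: t0.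
have neq i : i != j -> lam i != lam j.
  move=> ij; apply/eqP => lij.
  have := part i.+1; rewrite big_mkcond big_nat_recr//= ij lij subrr normr0 inver eqxx.
  rewrite gt0_muley ?lte_fin// addey ?leye_eq//.
  by rewrite -ltNye; apply: lt_le_trans (sume_ge0 _ _) => // k _; case: ifP.
split => // N; rewrite -lee_fin; apply: le_trans (part N).
rewrite -sumEFin; apply: lee_sum => i ij.
by rewrite inver normr_eq0 subr_eq0 eq_sym (negbTE (neq i ij)) EFinM.
Qed.

End rates.

Theorem theorem2p5 (R : realType) (d : nat) (T : set 'rV[R]_d) (cT : compact T)
    (m : nat -> R) (m_gt0 : forall k, 0 < m k)
    (m_oo : m k @[k --> \oo] --> +oo)
    (S : nat -> eigen_setup (lebesgue_on cT))
    (a h p : R) (a_gt0 : 0 < a) (h_ge1 : 1 <= h) (p_ge1 : 1 <= p)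
    (Jplus : nat -> nat) (Jplus_gt0 : forall k, (0 < Jplus k)%N)
    (C : R) (C_gt0 : 0 < C) (s : nat -> R) (s_o1 : s k @[k --> \oo] --> 0) :
  let q : R := p * 2 ^+ (`|Num.ceil (h / a)|%N + 4) in
  (* (1) *)
  (forall k i j, ((m k `^ 2^-1)%:E *
     'N[Pr (S k)]_q%:E[EFin \o centered (Pr (S k)) (etaD (S k) i j)] <= C%:E)%E) ->
  (forall k i j, ((m k `^ 2^-1)%:E *
     'N[Pr (S k)]_q%:E[EFin \o etaR (S k) i j] <= (s k)%:E)%E) ->
  (* (2); in [\bar R], x / 0 = +oo for x > 0, so the finite bounds force
     lambda_i <> lambda_j for i <> j and j below [Jplus] *)
  (forall k j, (j < Jplus k)%N ->
     ((m k `^ (- 2^-1 + a))%:E * \sum_(0 <= i <oo | i != j)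
        ((lambda (S k) i)%:E / `|lambda (S k) j - lambda (S k) i|%:E) <= C%:E)%E) ->
  (forall k j, (j < Jplus k)%N ->
     ((m k `^ (- 1 + 2 * a))%:E * \sum_(0 <= i <oo | i != j)
        ((lambda (S k) i * lambda (S k) j)%:E /
         ((lambda (S k) j - lambda (S k) i) ^+ 2)%:E) <= C%:E)%E) ->
  (forall k, m k `^ (- h) / C <= lambda (S k) (Jplus k).-1) ->
  (* (3) *)
  (forall k j, ((C^-1)%:E <= 'E_(Pr (S k))[etaD (S k) j j] <= C%:E)%E) ->
  (forall k, (\sum_(0 <= j <oo) (lambda (S k) j)%:E <= C%:E)%E) ->
  exists c : R, forall k J, (0 < J)%N -> (J < Jplus k)%N ->
    ('N[Pr (S k)]_p%:E[(fun w =>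
       (\big[Num.max/0]_(j < J)
          `|(lambda (S k) j)^-1 *
            (lambdahat (S k) j w - lambda (S k) j - Idev (S k) j j w)|)%:E)]
     <= (c * (J%:R `^ p^-1 * m k `^ (- a) / Num.sqrt (m k)))%:E)%E.
Proof.
move=> q H1D H1R H2 _ Hlow H3 H3s.
have [mi mi0 miP] : exists2 b, 0 < b & forall k, (m k)^-1 <= b.
  apply: (@eventually_bounded _ _ 1).
  move/cvgryPge/(_ 1) : m_oo; apply: filterS => k mk1.
  by rewrite invf_le1.
have [sb sb0 sP] : exists2 b, 0 < b & forall k, s k <= b.
  apply: (@eventually_bounded _ _ 1).
  have /cvgrPdist_le/(_ 1 ltr01) := s_o1; apply: filterS => k.
  by rewrite sub0r normrN; exact: le_trans (ler_norm _).
(* The power of X that pays for the bad event: 2 n p = q. *)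
pose n := (2 ^ (`|Num.ceil (h / a)| + 3))%N.
have n0 : (0 < n)%N by rewrite expn_gt0.
pose D := C + sb.
have D0 : 0 < D by rewrite addr_gt0.
exists (rate_constant C D a h mi^-1 n) => k J J0 JJ.
have p0 : 0 < p := lt_le_trans ltr01 p_ge1.
have mk0 := m_gt0 k.
have mik : mi^-1 <= m k by rewrite -[leRHS]invrK lef_pV2 ?posrE ?invr_gt0.
have qE : 2 * (n%:R * p) <= q.
  by rewrite /q /n natrX mulrA [leRHS]mulrC -exprS addn3 addn4.
have q1 : 1 <= q.
  by apply: le_trans qE; rewrite mulr_ege1 ?ler1n// mulr_ege1// ler1n.
pose B := C * m k `^ (2^-1 - a).
pose sg := D * m k `^ (- 2^-1).
have sg0 : 0 < sg by rewrite mulr_gt0// powR_gt0.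
have lamj j : (j < Jplus k)%N -> m k `^ (- h) / C <= lambda (S k) j.
  move=> jJ; apply: le_trans (Hlow k) _; apply: lambda_le.
  by rewrite -ltnS prednK.
have lamj0 j : (j < Jplus k)%N -> 0 < lambda (S k) j.
  by move=> /lamj; apply: lt_le_trans; rewrite divr_gt0// powR_gt0.
have gaps j : (j < Jplus k)%N ->
    (forall i, i != j -> lambda (S k) i != lambda (S k) j) /\
    (forall N, \sum_(0 <= i < N | i != j)
      lambda (S k) i / `|lambda (S k) j - lambda (S k) i| <= B).
  move=> jJ; apply: gap_series_bounds; [exact: lambda_ge0|exact: lamj0|].
  have := H2 k j jJ; rewrite -lee_pdivlMl ?powR_gt0// -EFinM.
  by rewrite -powRN mulrC opprD opprK.
(* J >= 1 puts the index 1 below Jplus, and lambda_0 / (lambda_0 - lambda_1) is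
   one of the terms of its gap series and is at least 1. *)
have B1 : 1 <= B.
  have J1 : (1 < Jplus k)%N by exact: leq_ltn_trans JJ.
  have [neq sB] := gaps 1%N J1.
  apply: le_trans (sB 1%N); rewrite big_mkcond big_nat1/=.
  have l10 : lambda (S k) 1%N < lambda (S k) 0%N.
    by rewrite lt_neqAle eq_sym neq//= lambda_le.
  rewrite ltr0_norm ?subr_lt0// opprB ler_pdivlMr ?subr_gt0// mul1r.
  by rewrite gerBl lambda_ge0.
have noiseq i l : ('N[Pr (S k)]_q%:E[EFin \o noise i l] <= sg%:E)%E.
  have -> : sg = C * m k `^ (- 2^-1) + sb * m k `^ (- 2^-1) by rewrite /sg mulrDl.
  apply: noise_Lnorm => //.
  - by rewrite mulr_ge0 ?powR_ge0// ltW.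
  - have := H1D k i l; rewrite -lee_pdivlMl ?powR_gt0// -EFinM.
    by rewrite -powRN mulrC.
  - have := H1R k i l; rewrite -lee_pdivlMl ?powR_gt0// -EFinM.
    move=> /le_trans; apply; rewrite lee_fin -powRN mulrC.
    by rewrite ler_wpM2r ?powR_ge0.
have lamC N : \sum_(0 <= i < N) lambda (S k) i <= C.
  rewrite -lee_fin -sumEFin; apply: le_trans (H3s k).
  by apply: nneseries_lim_ge => i _ _; rewrite lee_fin lambda_ge0.
have -> : rate_constant C D a h mi^-1 n * (J%:R `^ p^-1 * m k `^ (- a) / Num.sqrt (m k)) =
    J%:R `^ p^-1 * (rate_constant C D a h mi^-1 n * m k `^ (- 2^-1 - a)).
  rewrite -powR12_sqrt ?(ltW mk0)// -powRN.
  rewrite (_ : m k `^ (- 2^-1 - a) = m k `^ (- 2^-1) * m k `^ (- a)); first by ring.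
  by rewrite -powRD// (gt_eqF mk0) implybT.
apply: (@max_moment _ _ _ (Pr (S k)) J (fun j => @relative_error _ _ _ _ (S k) j)) => //.
- by rewrite mulr_ge0 ?powR_ge0// rate_constant_ge0// ltW.
- by move=> j; exact: measurable_relative_error.
- by move=> j x; exact: normr_ge0.
move=> j jJ; have jJp := ltn_trans jJ JJ.
have [neq sB] := gaps j jJp.
have eps0 : 0 < m k `^ (2^-1 - a - h) by rewrite powR_gt0.
apply: le_trans (relative_error_moment (lamj0 j jJp) B1 neq sB n0 eps0 p_ge1 qE sg0 C_gt0
  lamC (fun i => lambdat_le C_gt0 (H3 k i)) noiseq) _.
rewrite lee_fin; apply: rate_le => //; rewrite ?invr_gt0//.
- exact: exponent_large.
- exact: lamj.
Qed.
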